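(* For every real $x>0$ one has the functional equation $$\sum_{k\in\mathbb{Z}}\operatorname{sech}(xk)=\frac{\pi}{x}\sum_{k\in\mathbb{Z}}\operatorname{sech}\left(\frac{\pi^2}{x}k\right),$$ and it is equivalent to the functional equation $$F(x)=\frac{\pi}{4x}-\frac14+\frac{\pi}{x}F\left(\frac{\pi^2}{x}\right),\qquad\text{where } F(x)=\sum_{k=1}^\infty\frac{e^{-kx}}{1+e^{-2kx}}.$$ Moreover, for every $r\in\mathbb{N}$, $r\ge1$, $$q_{r,k}=\frac{\pi}{\sqrt{r}\cdot 2K(k_r)}\operatorname{sech}\left(\frac{\pi}{\sqrt{r}}k\right),\qquad k\in\mathbb{Z},$$ is a probability mass function on $\mathbb{Z}$ (that is, its terms are nonnegative and sum to $1$).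
   Context: $\operatorname{sech}(x)=1/\cosh(x)$. For $k\in(0,1)$, $K(k)=\int_0^{\pi/2}\frac{\mathrm{d}\vartheta}{\sqrt{1-k^2\sin^2\vartheta}}$ is the complete elliptic integral of the first kind with modulus $k$, and $K'(k)=K(\sqrt{1-k^2})$. For $r\ge 1$, $k_r=\lambda^\star(r)\in(0,1)$ denotes the (unique) modulus with $K'(k_r)/K(k_r)=\sqrt{r}$. The distribution with probability mass function $(q_{r,k})_{k\in\mathbb{Z}}$ is called the discrete bilateral hyperbolic secant distribution with scaling factor $1/\sqrt r$. *)

(* Defs.v *)
From Stdlib Require Import Reals ZArith.
From Coquelicot Require Import Coquelicot.
Open Scope R_scope.

Definition sech (x : R) : R := / cosh x.

(* A series over Z converges when its two halves, k >= 0 and k <= -1, both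
   converge. All the series over Z used below have nonnegative terms, so this
   agrees with unconditional summation. *)
Definition is_series_Z (a : Z -> R) (s : R) : Prop :=
  exists s1 s2 : R,
    is_series (fun n : nat => a (Z.of_nat n)) s1 /\
    is_series (fun n : nat => a (- Z.of_nat (S n))%Z) s2 /\
    s = s1 + s2.

Definition ex_series_Z (a : Z -> R) : Prop := exists s : R, is_series_Z a s.

(* Meaningful only under [ex_series_Z a]: [Series] is a total operator. *)
Definition Series_Z (a : Z -> R) : R :=
  Series (fun n : nat => a (Z.of_nat n)) +
  Series (fun n : nat => a (- Z.of_nat (S n))%Z).

Definition F_term (x : R) (k : nat) : R :=
  exp (- (INR k * x)) / (1 + exp (- (2 * INR k * x))).

(* The sum starts at k = 1, hence the shift. *)
Definition F (x : R) : R := Series (fun n : nat => F_term x (S n)).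

Definition ellipticK (k : R) : R :=
  RInt (fun t : R => 1 / sqrt (1 - k ^ 2 * sin t ^ 2)) 0 (PI / 2).

Definition ellipticK' (k : R) : R := ellipticK (sqrt (1 - k ^ 2)).

Definition is_elliptic_modulus (r k : R) : Prop :=
  0 < k < 1 /\ ellipticK' k / ellipticK k = sqrt r.

(* [iota P] is Coquelicot's "the unique k such that P k": [iota_correct] gives
   P (iota P) only from a proof of [exists! k, P k]. *)
Definition lambda_star (r : R) : R := iota (is_elliptic_modulus r).

Definition is_pmf_Z (p : Z -> R) : Prop :=
  (forall k : Z, 0 <= p k) /\ is_series_Z p 1.

Definition q (r : nat) (k : Z) : R :=
  PI / (sqrt (INR r) * (2 * ellipticK (lambda_star (INR r)))) *
  sech (PI / sqrt (INR r) * IZR k).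

(* Main.v *)
(* Write A(x), B(x), C(x) for the sums over k in Z of sech(x k), (-1)^k sech(x k)
   and sech(x (k + 1/2)). Multiplying out, telescoping
   sech a sech b = (tanh b - tanh a) / sinh (b - a), and expanding the diagonal
   terms as a Lambert series gives C(x)^2 = 4 A(2x) C(2x), hence A^2 = B^2 + C^2
   and the AGM steps (A, B)(x) -> (A, B)(2x), (A, C)(2x) -> (A/2, C/2)(x).
   The integral I(a, b) of 1 / sqrt (a^2 cos^2 + b^2 sin^2) over [0, PI/2] is
   invariant under AGM steps, so that I(A, B) = PI/2 by letting x -> oo, while
   I(A, C)(2x) = 2 I(A, C)(x), and I(a, c) ~ ln (1/c) as c -> 0 and a -> 1 then
   forces I(A, C) = x/2.
   With k = C/A and k' = B/A this reads K(k) = A PI/2 and K'(k) = A x/2, so that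
   K'/K = x/PI. Since K'/K is injective, replacing x by PI^2/x swaps k and k',
   which is the functional equation. *)
Require Import Defs.
From Stdlib Require Import Reals ZArith Lra Lia.
From Coquelicot Require Import Coquelicot.
Open Scope R_scope.

(** * Series over the integers *)

(** A, B and C are the squares of Jacobi's theta constants theta_3, theta_4 and theta_2 at the nome
    exp (- x), so C/A is the classical parametrization of the modulus; here everything about them is
    obtained from rearranged double series. Each rearrangement has nonnegative terms and rests on
    Tonelli, which is why B is introduced as A(2x) - C(2x) instead of an alternating series. The
    Lambert series is V(x), the sum of k / sinh (x k): both C(x)^2 / 4 and A(2x) C(2x) turn out to
    be V(x) - 2 V(2x). Limits are taken only along x, 2x, 4x, ..., where A and B tend to 1 and C
    decays like exp (- X / 2). For I(A, C), which blows up, an estimate up to a bounded error is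
    enough: n doublings multiply the integral by 2^n, and dividing by 2^n removes the error. The
    modulus k_r exists because the parametrization exhibits it, at x = PI sqrt r; the dual argument
    PI^2 / x is then PI / sqrt r, the one in the mass function. *)

Lemma is_series_Rplus (a b : nat -> R) (s t : R) :
  is_series a s -> is_series b t -> is_series (fun n => a n + b n) (s + t).
Proof. exact (is_series_plus a b s t). Qed.

Lemma is_series_Rscal (c : R) (a : nat -> R) (s : R) :
  is_series a s -> is_series (fun n => c * a n) (c * s).
Proof. exact (is_series_scal c a s). Qed.

Lemma is_series_eq (a b : nat -> R) (s t : R) :
  (forall n, a n = b n) -> s = t -> is_series a s -> is_series b t.
Proof. intros Hab <- Ha. exact (is_series_ext a b s Hab Ha). Qed.

Lemma is_series_uniq (a : nat -> R) (s t : R) :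
  is_series a s -> is_series a t -> s = t.
Proof.
  intros Hs Ht. rewrite <- (is_series_unique a s Hs). now apply is_series_unique.
Qed.

Lemma ex_series_le_pos (a b : nat -> R) :
  (forall n, 0 <= a n <= b n) -> ex_series b -> ex_series a.
Proof.
  intros Hab Hb. apply (ex_series_le a b); [|exact Hb].
  intros n. change (norm (a n)) with (Rabs (a n)).
  rewrite Rabs_pos_eq; apply Hab.
Qed.

Lemma is_series_cons (a : nat -> R) (s : R) :
  is_series (fun n => a (S n)) s -> is_series a (a 0%nat + s).
Proof.
  intros Hs. apply is_series_decr_1.
  change (is_series (fun k => a (S k)) (a 0%nat + s + - a 0%nat)).
  now replace (a 0%nat + s + - a 0%nat) with s by ring.
Qed.

Lemma is_series_tail (a : nat -> R) (s : R) :
  is_series a s -> is_series (fun n => a (S n)) (s - a 0%nat).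
Proof.
  intros Hs. apply is_series_incr_1.
  change (is_series a (s - a 0%nat + a 0%nat)).
  now replace (s - a 0%nat + a 0%nat) with s by ring.
Qed.

Lemma is_series_even_odd (a : nat -> R) (s t : R) :
  is_series (fun n => a (2 * n)%nat) s ->
  is_series (fun n => a (2 * n + 1)%nat) t ->
  is_series a (s + t).
Proof.
  intros Hs Ht.
  (* At the point 1 a power series is the plain series of its coefficients, so its even-odd
     splitting is the one wanted. *)
  assert (H := is_pseries_odd_even a 1 s t).
  rewrite !is_pseries_R in H.
  assert (Hs' : is_series (fun n => a (2 * n)%nat * (1 ^ 2) ^ n) s).
  { revert Hs. apply is_series_eq; [|reflexivity]. intros n. rewrite !pow1. ring. }
  assert (Ht' : is_series (fun n => a (2 * n + 1)%nat * (1 ^ 2) ^ n) t).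
  { revert Ht. apply is_series_eq; [|reflexivity]. intros n. rewrite !pow1. ring. }
  generalize (H Hs' Ht'). apply is_series_eq; [|ring].
  intros n. rewrite pow1. ring.
Qed.

Lemma is_series_telescope (f : nat -> R) (l : R) :
  is_lim_seq f l -> is_series (fun n => f (S n) - f n) (l - f 0%nat).
Proof.
  intros Hf.
  change (is_lim_seq (sum_n (fun n => f (S n) - f n)) (l - f 0%nat)).
  apply (is_lim_seq_ext (fun n => f (S n) - f 0%nat)).
  - intros n. induction n as [|n IH].
    + now rewrite sum_O.
    + rewrite sum_Sn, <- IH. change plus with Rplus. simpl. ring.
  - apply is_lim_seq_minus'; [|apply is_lim_seq_const].
    now apply is_lim_seq_incr_1 in Hf.
Qed.

Lemma is_series_partial_le (a : nat -> R) (s : R) (N : nat) :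
  (forall n, 0 <= a n) -> is_series a s -> sum_n a N <= s.
Proof.
  intros Ha Hs. apply (is_lim_seq_incr_compare (sum_n a) s Hs).
  intros n. rewrite sum_Sn. change plus with Rplus. specialize (Ha (S n)). lra.
Qed.

Lemma is_series_nonneg (a : nat -> R) (s : R) :
  (forall n, 0 <= a n) -> is_series a s -> 0 <= s.
Proof.
  intros Ha Hs. generalize (is_series_partial_le a s 0 Ha Hs) (Ha 0%nat).
  rewrite sum_O. lra.
Qed.

(** A finite sum of columns is the series of truncated rows, each at most [r n], so the partial sums
    of [c] increase and stay below [S]. Equality follows by running the same bound with rows and
    columns exchanged. *)
Lemma is_series_tonelli_le (a : nat -> nat -> R) (r c : nat -> R) (S : R) :
  (forall n m, 0 <= a n m) ->
  (forall n, is_series (a n) (r n)) ->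
  (forall m, is_series (fun n => a n m) (c m)) ->
  is_series r S ->
  exists S', is_series c S' /\ S' <= S.
Proof.
  intros Ha Hr Hc HS.
  assert (Hc0 : forall m, 0 <= c m).
  { intros m. apply (is_series_nonneg (fun n => a n m)); [intros n; apply Ha|apply Hc]. }
  assert (Hcol : forall M, is_series (fun n => sum_n (a n) M) (sum_n c M)).
  { intros M. induction M as [|M IH].
    - generalize (Hc 0%nat). apply is_series_eq; [intros n|]; now rewrite sum_O.
    - generalize (is_series_Rplus _ _ _ _ IH (Hc (Datatypes.S M))).
      apply is_series_eq; [intros n|]; now rewrite sum_Sn. }
  assert (Hpart : forall n M, 0 <= sum_n (a n) M <= r n).
  { intros n M. split.
    - induction M as [|M IH]; [rewrite sum_O; apply Ha|].
      rewrite sum_Sn. apply Rplus_le_le_0_compat; [exact IH|apply Ha].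
    - apply is_series_partial_le; [apply Ha|apply Hr]. }
  assert (Hbd : forall M, sum_n c M <= S).
  { intros M. rewrite <- (is_series_unique _ _ (Hcol M)), <- (is_series_unique _ _ HS).
    apply Series_le; [intros n; apply Hpart|now exists S]. }
  destruct (ex_finite_lim_seq_incr (sum_n c) S) as [l Hl].
  - intros n. rewrite sum_Sn. change plus with Rplus. specialize (Hc0 (Datatypes.S n)). lra.
  - exact Hbd.
  - exists l. split; [exact Hl|].
    exact (is_lim_seq_le _ (fun _ => S) l S Hbd Hl (is_lim_seq_const S)).
Qed.

Lemma is_series_tonelli (a : nat -> nat -> R) (r c : nat -> R) (S : R) :
  (forall n m, 0 <= a n m) ->
  (forall n, is_series (a n) (r n)) ->
  (forall m, is_series (fun n => a n m) (c m)) ->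
  is_series r S -> is_series c S.
Proof.
  intros Ha Hr Hc HS.
  destruct (is_series_tonelli_le a r c S Ha Hr Hc HS) as [S' [HS' Hle]].
  destruct (is_series_tonelli_le (fun m n => a n m) c r S' (fun m n => Ha n m) Hc Hr HS')
    as [S'' [HS'' Hle']].
  rewrite (is_series_uniq _ _ _ HS HS'') in Hle |- *.
  now replace S'' with S' by lra.
Qed.

Lemma is_series_Z_uniq (a : Z -> R) (s t : R) :
  is_series_Z a s -> is_series_Z a t -> s = t.
Proof.
  intros (s1 & s2 & H1 & H2 & ->) (t1 & t2 & H3 & H4 & ->).
  now rewrite (is_series_uniq _ _ _ H1 H3), (is_series_uniq _ _ _ H2 H4).
Qed.

Lemma is_series_Z_eq (a b : Z -> R) (s t : R) :
  (forall k, a k = b k) -> s = t -> is_series_Z a s -> is_series_Z b t.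
Proof.
  intros Hab <- (s1 & s2 & H1 & H2 & ->). exists s1, s2.
  split; [|split]; [revert H1|revert H2|reflexivity];
    apply is_series_eq; intros; try apply Hab; reflexivity.
Qed.

Lemma is_series_Z_unique (a : Z -> R) (s : R) : is_series_Z a s -> Series_Z a = s.
Proof.
  intros (s1 & s2 & H1 & H2 & ->). unfold Series_Z.
  now rewrite (is_series_unique _ _ H1), (is_series_unique _ _ H2).
Qed.

Lemma is_series_Z_plus (a b : Z -> R) (s t : R) :
  is_series_Z a s -> is_series_Z b t -> is_series_Z (fun k => a k + b k) (s + t).
Proof.
  intros (s1 & s2 & H1 & H2 & ->) (t1 & t2 & H3 & H4 & ->).
  exists (s1 + t1), (s2 + t2).
  split; [|split]; [now apply is_series_Rplus|now apply is_series_Rplus|ring].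
Qed.

Lemma is_series_Z_scal (c : R) (a : Z -> R) (s : R) :
  is_series_Z a s -> is_series_Z (fun k => c * a k) (c * s).
Proof.
  intros (s1 & s2 & H1 & H2 & ->). exists (c * s1), (c * s2).
  split; [|split]; [now apply is_series_Rscal|now apply is_series_Rscal|ring].
Qed.

Lemma is_series_Z_succ (a : Z -> R) (s : R) :
  is_series_Z a s -> is_series_Z (fun k => a (k + 1)%Z) s.
Proof.
  intros (s1 & s2 & H1 & H2 & ->). exists (s1 - a 0%Z), (a 0%Z + s2).
  split; [|split; [|ring]].
  - generalize (is_series_tail _ _ H1). apply is_series_eq; [|reflexivity].
    intros n. f_equal. lia.
  - generalize (is_series_cons (fun n => a (- Z.of_nat n)%Z) s2 H2).
    apply is_series_eq; [|reflexivity]. intros n. f_equal. lia.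
Qed.

Lemma is_series_Z_opp (a : Z -> R) (s : R) :
  is_series_Z a s -> is_series_Z (fun k => a (- k)%Z) s.
Proof.
  (* Negation does not exchange the halves k >= 0 and k <= -1 exactly, because of the term at 0;
     after a shift by one the halves carry the indices k >= 1 and k <= 0, which are the two
     needed. *)
  intros H. apply is_series_Z_succ in H. destruct H as (s1 & s2 & H1 & H2 & ->).
  exists s2, s1. split; [|split; [|ring]].
  - revert H2. apply is_series_eq; [|reflexivity]. intros n. f_equal. lia.
  - revert H1. apply is_series_eq; [|reflexivity]. intros n. f_equal. lia.
Qed.

Lemma is_series_Z_shift (a : Z -> R) (s : R) (d : Z) :
  is_series_Z a s -> is_series_Z (fun k => a (k + d)%Z) s.
Proof.
  assert (Hnat : forall (b : Z -> R) (n : nat),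
    is_series_Z b s -> is_series_Z (fun k => b (k + Z.of_nat n)%Z) s).
  { intros b n Hb. induction n as [|n IH].
    - revert Hb. apply is_series_Z_eq; [|reflexivity]. intros k. f_equal. lia.
    - apply is_series_Z_succ in IH. revert IH. apply is_series_Z_eq; [|reflexivity].
      intros k. f_equal. lia. }
  intros Ha. destruct (Z_le_dec 0 d) as [Hd|Hd].
  - generalize (Hnat a (Z.to_nat d) Ha). apply is_series_Z_eq; [|reflexivity].
    intros k. f_equal. lia.
  - generalize (is_series_Z_opp _ _ (Hnat _ (Z.to_nat (- d)) (is_series_Z_opp a s Ha))).
    apply is_series_Z_eq; [|reflexivity]. intros k. f_equal. lia.
Qed.

Lemma is_series_Z_even_odd (a : Z -> R) (s t : R) :
  is_series_Z (fun k => a (2 * k)%Z) s ->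
  is_series_Z (fun k => a (2 * k + 1)%Z) t ->
  is_series_Z a (s + t).
Proof.
  intros (s1 & s2 & H1 & H2 & ->) (t1 & t2 & H3 & H4 & ->).
  (* On the negative half, position n holds the index - (n + 1), so even positions carry odd
     indices; hence the order [t2 + s2]. *)
  exists (s1 + t1), (t2 + s2). split; [|split; [|ring]]; apply is_series_even_odd.
  - revert H1. apply is_series_eq; [|reflexivity]. intros n. f_equal. lia.
  - revert H3. apply is_series_eq; [|reflexivity]. intros n. f_equal. lia.
  - revert H4. apply is_series_eq; [|reflexivity]. intros n. f_equal. lia.
  - revert H2. apply is_series_eq; [|reflexivity]. intros n. f_equal. lia.
Qed.

Lemma is_series_Z_fold (a : Z -> R) (s : R) :
  is_series_Z a s ->
  is_series (fun n => a (Z.of_nat n) + a (- Z.of_nat (S n))%Z) s.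
Proof. intros (s1 & s2 & H1 & H2 & ->). now apply is_series_Rplus. Qed.

(** Nonnegativity makes each half dominated by the paired series. Pairing k with - (k + 1) reduces
    double series over the integers to the case of [nat]. *)
Lemma is_series_Z_unfold (a : Z -> R) (s : R) :
  (forall k, 0 <= a k) ->
  is_series (fun n => a (Z.of_nat n) + a (- Z.of_nat (S n))%Z) s ->
  is_series_Z a s.
Proof.
  intros Ha Hs.
  assert (H1 : ex_series (fun n => a (Z.of_nat n))).
  { eapply ex_series_le_pos; [|exists s; exact Hs].
    intros n. generalize (Ha (Z.of_nat n)) (Ha (- Z.of_nat (S n))%Z). cbv beta. lra. }
  assert (H2 : ex_series (fun n => a (- Z.of_nat (S n))%Z)).
  { eapply ex_series_le_pos; [|exists s; exact Hs].
    intros n. generalize (Ha (Z.of_nat n)) (Ha (- Z.of_nat (S n))%Z). cbv beta. lra. }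
  destruct H1 as [s1 H1], H2 as [s2 H2]. exists s1, s2. split; [|split]; trivial.
  exact (is_series_uniq _ _ _ Hs (is_series_Rplus _ _ _ _ H1 H2)).
Qed.

Lemma is_series_Z_nonneg (a : Z -> R) (s : R) :
  (forall k, 0 <= a k) -> is_series_Z a s -> 0 <= s.
Proof.
  intros Ha Hs. apply is_series_Z_fold in Hs. revert Hs. apply is_series_nonneg.
  intros n. apply Rplus_le_le_0_compat; apply Ha.
Qed.

Lemma is_series_Z_tonelli (a : Z -> Z -> R) (r c : Z -> R) (S : R) :
  (forall n m, 0 <= a n m) ->
  (forall n, is_series_Z (a n) (r n)) ->
  (forall m, is_series_Z (fun n => a n m) (c m)) ->
  is_series_Z r S -> is_series_Z c S.
Proof.
  intros Ha Hr Hc HS. apply is_series_Z_unfold.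
  - intros m. apply (is_series_Z_nonneg (fun n => a n m)); [|apply Hc].
    intros n. apply Ha.
  - apply is_series_Z_fold in HS. revert HS.
    set (neg := fun n : nat => (- Z.of_nat (Datatypes.S n))%Z).
    (* The four quadrants of the integer lattice are superposed into one array over [nat]. *)
    apply (is_series_tonelli (fun n m =>
      (a (Z.of_nat n) (Z.of_nat m) + a (Z.of_nat n) (neg m)) +
      (a (neg n) (Z.of_nat m) + a (neg n) (neg m)))).
    + intros n m. repeat apply Rplus_le_le_0_compat; apply Ha.
    + intros n. apply is_series_Rplus; exact (is_series_Z_fold _ _ (Hr _)).
    + intros m.
      generalize (is_series_Rplus _ _ _ _ (is_series_Z_fold _ _ (Hc (Z.of_nat m)))
                    (is_series_Z_fold _ _ (Hc (neg m)))).
      apply is_series_eq; [|reflexivity]. intros n. unfold neg. ring.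
Qed.

(** * Bilateral sums of the hyperbolic secant *)

Lemma ex_series_Z_le (a b : Z -> R) :
  (forall k, 0 <= a k <= b k) -> ex_series_Z b -> ex_series_Z a.
Proof.
  intros Hab (s & s1 & s2 & H1 & H2 & _).
  destruct (ex_series_le_pos (fun n => a (Z.of_nat n)) _ (fun n => Hab _) (ex_intro _ _ H1))
    as [t1 H3].
  destruct (ex_series_le_pos (fun n => a (- Z.of_nat (S n))%Z) _ (fun n => Hab _)
              (ex_intro _ _ H2)) as [t2 H4].
  now exists (t1 + t2), t1, t2.
Qed.

Lemma ex_series_Z_correct (a : Z -> R) : ex_series_Z a -> is_series_Z a (Series_Z a).
Proof. intros [s Hs]. now rewrite (is_series_Z_unique _ _ Hs). Qed.

Lemma is_series_0 : is_series (fun _ => 0) 0.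
Proof.
  assert (H : Rabs 0 < 1) by (rewrite Rabs_R0; lra).
  generalize (is_series_Rscal 0 _ _ (is_series_geom 0 H)).
  apply is_series_eq; intros; ring.
Qed.

Lemma is_series_Z_at_0 (v : R) :
  is_series_Z (fun k => if Z.eq_dec k 0 then v else 0) v.
Proof.
  exists v, 0. split; [|split; [|ring]].
  - apply (is_series_eq (fun n => match n with O => v | S _ => 0 end) _ (v + 0) v).
    + intros [|n]; reflexivity.
    + ring.
    + apply (is_series_cons (fun n => match n with O => v | S _ => 0 end)). exact is_series_0.
  - apply (is_series_eq (fun _ => 0) _ 0 0); [reflexivity|reflexivity|exact is_series_0].
Qed.

Lemma cosh_pos (y : R) : 0 < cosh y.
Proof. unfold cosh. generalize (exp_pos y) (exp_pos (- y)). lra. Qed.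

Lemma sech_pos (y : R) : 0 < sech y.
Proof. apply Rinv_0_lt_compat, cosh_pos. Qed.

Lemma sech_opp (y : R) : sech (- y) = sech y.
Proof. unfold sech, cosh. rewrite Ropp_involutive. f_equal. lra. Qed.

Lemma sech_le_exp (y : R) : sech y <= 2 * exp (- y).
Proof.
  unfold sech, cosh. rewrite exp_Ropp. generalize (exp_pos y); intros Hy.
  replace (/ ((exp y + / exp y) / 2)) with (2 * exp y / (exp y ^ 2 + 1)) by (field; nra).
  apply (Rmult_le_reg_r (exp y * (exp y ^ 2 + 1))); [nra|]. field_simplify; nra.
Qed.

Lemma sech_ge_exp (y : R) : 0 <= y -> exp (- y) <= sech y.
Proof.
  intros Hy. unfold sech, cosh. rewrite exp_Ropp.
  assert (H : 1 <= exp y) by (generalize (exp_ineq1_le y); lra).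
  apply Rinv_le_contravar; [|apply (Rmult_le_reg_r (2 * exp y)); [lra|field_simplify; nra]].
  generalize (Rinv_0_lt_compat (exp y)). lra.
Qed.

Lemma sech_le_1 (y : R) : sech y <= 1.
Proof.
  unfold sech. rewrite <- Rinv_1. apply Rinv_le_contravar; [lra|].
  unfold cosh. rewrite exp_Ropp. generalize (exp_pos y); intros Hy.
  apply (Rmult_le_reg_r (2 * exp y)); [lra|]. field_simplify; [|lra].
  generalize (pow2_ge_0 (exp y - 1)). lra.
Qed.

Lemma is_series_exp (x : R) :
  0 < x -> is_series (fun n => exp (- (x * INR n))) (/ (1 - exp (- x))).
Proof.
  intros Hx. assert (H : Rabs (exp (- x)) < 1).
  { rewrite Rabs_pos_eq by apply Rlt_le, exp_pos. rewrite <- exp_0. apply exp_increasing. lra. }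
  generalize (is_series_geom _ H). apply is_series_eq; [|reflexivity].
  intros n. induction n as [|n IH].
  - simpl. now rewrite Rmult_0_r, Ropp_0, exp_0.
  - rewrite S_INR, <- tech_pow_Rmult, IH, <- exp_plus. f_equal. ring.
Qed.

(** The offsets [u = 0] and [u = 1 / 2] give A(x) and C(x) of the overview. *)
Definition sech_sum (x u : R) : R := Series_Z (fun k => sech (x * (IZR k + u))).

Lemma is_sech_sum (x u : R) :
  0 < x -> is_series_Z (fun k => sech (x * (IZR k + u))) (sech_sum x u).
Proof.
  intros Hx. apply ex_series_Z_correct.
  assert (H1 : ex_series (fun n => sech (x * (IZR (Z.of_nat n) + u)))).
  { apply (ex_series_le_pos _ (fun n => 2 * exp (- (x * u)) * exp (- (x * INR n)))).
    - intros n. split; [apply Rlt_le, sech_pos|].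
      eapply Rle_trans; [apply sech_le_exp|]. rewrite Rmult_assoc, <- exp_plus.
      apply Req_le. do 2 f_equal. rewrite INR_IZR_INZ. ring.
    - eexists. apply is_series_Rscal, is_series_exp, Hx. }
  assert (H2 : ex_series (fun n => sech (x * (IZR (- Z.of_nat (S n)) + u)))).
  { apply (ex_series_le_pos _ (fun n => 2 * exp (x * (u - 1)) * exp (- (x * INR n)))).
    - intros n. split; [apply Rlt_le, sech_pos|].
      rewrite <- sech_opp. eapply Rle_trans; [apply sech_le_exp|].
      rewrite Rmult_assoc, <- exp_plus. apply Req_le. do 2 f_equal.
      rewrite opp_IZR, <- INR_IZR_INZ, S_INR. ring.
    - eexists. apply is_series_Rscal, is_series_exp, Hx. }
  destruct H1 as [s1 H1], H2 as [s2 H2]. now exists (s1 + s2), s1, s2.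
Qed.

Lemma is_series_Z_sech (x : R) :
  0 < x -> is_series_Z (fun k => sech (x * IZR k)) (sech_sum x 0).
Proof.
  intros Hx. generalize (is_sech_sum x 0 Hx). apply is_series_Z_eq; [|reflexivity].
  intros k. now rewrite Rplus_0_r.
Qed.

Lemma sech_sum_even_odd (x : R) :
  0 < x -> sech_sum x 0 = sech_sum (2 * x) 0 + sech_sum (2 * x) (1 / 2).
Proof.
  intros Hx. apply (is_series_Z_uniq (fun k => sech (x * (IZR k + 0)))).
  - now apply is_sech_sum.
  - apply is_series_Z_even_odd.
    + generalize (is_sech_sum (2 * x) 0 ltac:(lra)). apply is_series_Z_eq; [|reflexivity].
      intros k. f_equal. rewrite mult_IZR. ring.
    + generalize (is_sech_sum (2 * x) (1 / 2) ltac:(lra)). apply is_series_Z_eq; [|reflexivity].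
      intros k. f_equal. rewrite plus_IZR, mult_IZR. field.
Qed.

Lemma tanh_minus (a b : R) : tanh b - tanh a = sinh (b - a) * (sech a * sech b).
Proof.
  unfold tanh, sech.
  replace (sinh (b - a)) with (sinh b * cosh a - cosh b * sinh a).
  - generalize (cosh_pos a) (cosh_pos b). intros. field. lra.
  - unfold sinh, cosh. rewrite Ropp_minus_distr. unfold Rminus. rewrite !exp_plus. field.
Qed.

Lemma tanh_opp (y : R) : tanh (- y) = - tanh y.
Proof.
  unfold tanh, sinh, cosh. rewrite Ropp_involutive.
  generalize (exp_pos y) (exp_pos (- y)). intros. field. lra.
Qed.

Lemma is_lim_seq_tanh (a p : R) :
  0 < p -> is_lim_seq (fun n => tanh (a + p * INR n)) 1.
Proof.
  intros Hp.
  assert (H : is_lim_seq (fun n => 2 * exp (- (2 * a)) * exp (- (2 * p * INR n))) 0).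
  { apply ex_series_lim_0. eexists. apply is_series_Rscal, is_series_exp. lra. }
  (* With [sech_le_exp] this bounds the distance of tanh y from 1 by 2 exp (- 2 y), the tail of a
     geometric series. *)
  assert (E : forall y, tanh y = 1 - exp (- y) * sech y).
  { intros y. generalize (cosh_pos y). intros. unfold tanh, sech.
    field_simplify_eq; [|lra]. unfold sinh, cosh. field. }
  apply (is_lim_seq_le_le
           (fun n => 1 - 2 * exp (- (2 * a)) * exp (- (2 * p * INR n))) _ (fun _ => 1)).
  - intros n. rewrite E. set (y := a + p * INR n).
    assert (H1 := sech_pos y). assert (H2 := sech_le_exp y). assert (H3 := exp_pos (- y)).
    replace (2 * exp (- (2 * a)) * exp (- (2 * p * INR n))) with (exp (- y) * (2 * exp (- y))).
    + split; [|nra].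
      apply Rplus_le_compat_l, Ropp_le_contravar, Rmult_le_compat_l; lra.
    + replace (exp (- y) * (2 * exp (- y))) with (2 * (exp (- y) * exp (- y))) by ring.
      rewrite Rmult_assoc, <- !exp_plus. unfold y. do 2 f_equal. ring.
  - replace 1 with (1 - 0) at 1 by ring. apply is_lim_seq_minus'; [apply is_lim_seq_const|exact H].
  - apply is_lim_seq_const.
Qed.

(** The sum telescopes to the full rise of tanh, from -1 to 1, whatever [a] and [p] are. The halves
    contribute 1 - tanh a and 1 + tanh a. *)
Lemma is_series_Z_tanh_step (a p : R) :
  0 < p -> is_series_Z (fun n => tanh (a + p * (IZR n + 1)) - tanh (a + p * IZR n)) 2.
Proof.
  intros Hp. exists (1 - tanh a), (1 - tanh (- a)). split; [|split].
  - generalize (is_series_telescope _ _ (is_lim_seq_tanh a p Hp)).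
    apply is_series_eq.
    + intros n. rewrite <- INR_IZR_INZ, S_INR. reflexivity.
    + simpl. now rewrite Rmult_0_r, Rplus_0_r.
  - generalize (is_series_telescope _ _ (is_lim_seq_tanh (- a) p Hp)).
    apply is_series_eq.
    + intros n. rewrite opp_IZR, <- INR_IZR_INZ, S_INR.
      replace (a + p * (- (INR n + 1) + 1)) with (- (- a + p * INR n)) by ring.
      replace (a + p * - (INR n + 1)) with (- (- a + p * (INR n + 1))) by ring.
      rewrite !tanh_opp. ring.
    + simpl. now rewrite Rmult_0_r, Rplus_0_r.
  - rewrite tanh_opp. ring.
Qed.

Lemma is_series_Z_tanh (a p : R) (d : Z) :
  0 < p ->
  is_series_Z (fun n => tanh (a + p * (IZR n + IZR d)) - tanh (a + p * IZR n)) (2 * IZR d).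
Proof.
  intros Hp.
  assert (Hnat : forall m : nat,
    is_series_Z (fun n => tanh (a + p * (IZR n + INR m)) - tanh (a + p * IZR n)) (2 * INR m)).
  { intros m. induction m as [|m IH].
    - generalize (is_series_Z_scal 0 _ _ (is_series_Z_tanh_step a p Hp)).
      apply is_series_Z_eq; [|simpl; ring]. intros k. simpl. rewrite Rplus_0_r. ring.
    - generalize (is_series_Z_plus _ _ _ _ IH (is_series_Z_tanh_step (a + p * INR m) p Hp)).
      apply is_series_Z_eq; [|rewrite S_INR; ring]. intros k. rewrite S_INR.
      replace (a + p * INR m + p * (IZR k + 1)) with (a + p * (IZR k + (INR m + 1))) by ring.
      replace (a + p * INR m + p * IZR k) with (a + p * (IZR k + INR m)) by ring. ring. }
  destruct (Z_le_dec 0 d) as [Hd|Hd].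
  - generalize (Hnat (Z.to_nat d)). rewrite INR_IZR_INZ, Z2Nat.id by exact Hd. trivial.
  (* For negative [d], shifting the index by [d] exchanges the two endpoints of the difference, at
     the cost of a sign. *)
  - generalize (is_series_Z_scal (-1) _ _ (is_series_Z_shift _ _ d (Hnat (Z.to_nat (- d))))).
    rewrite INR_IZR_INZ, Z2Nat.id by lia. rewrite opp_IZR.
    apply is_series_Z_eq; [|ring]. intros k. rewrite plus_IZR.
    replace (IZR k + IZR d + - IZR d) with (IZR k) by ring. ring.
Qed.

Lemma sinh_neq_0 (y : R) : y <> 0 -> sinh y <> 0.
Proof.
  intros Hy H. rewrite <- (arcsinh_sinh y), H, arcsinh_0 in Hy. lra.
Qed.

Lemma is_series_Z_sech_mul (a p : R) (d : Z) :
  0 < p -> d <> 0%Z ->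
  is_series_Z (fun n => sech (a + p * IZR n) * sech (a + p * (IZR n + IZR d)))
    (2 * IZR d / sinh (p * IZR d)).
Proof.
  intros Hp Hd. assert (Hs : sinh (p * IZR d) <> 0).
  { apply sinh_neq_0. apply Rmult_integral_contrapositive_currified; [lra|].
    now apply not_0_IZR. }
  generalize (is_series_Z_scal (/ sinh (p * IZR d)) _ _ (is_series_Z_tanh a p d Hp)).
  apply is_series_Z_eq; [|field; exact Hs]. intros n. rewrite tanh_minus.
  replace (a + p * (IZR n + IZR d) - (a + p * IZR n)) with (p * IZR d) by ring.
  now field.
Qed.

(* Shifting by half a period does not telescope; instead the reflection
   n -> - n - e identifies this sum with its complement in a full period. *)
Lemma is_series_Z_sech_mul_half (p : R) (e : Z) :
  0 < p -> e <> 0%Z ->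
  is_series_Z (fun n => sech (2 * p * IZR n) * sech (2 * p * IZR n + p * IZR e))
    (IZR e / sinh (p * IZR e)).
Proof.
  intros Hp He. assert (Hs : sinh (p * IZR e) <> 0).
  { apply sinh_neq_0. apply Rmult_integral_contrapositive_currified; [lra|].
    now apply not_0_IZR. }
  set (f := fun n => sech (2 * p * IZR n) * sech (2 * p * IZR n + p * IZR e)).
  assert (Hf : is_series_Z f (Series_Z f)).
  { apply ex_series_Z_correct. apply (ex_series_Z_le _ (fun k => sech (2 * p * (IZR k + 0)))).
    - intros k. unfold f. rewrite Rplus_0_r.
      assert (H1 := sech_pos (2 * p * IZR k)).
      assert (H2 := sech_pos (2 * p * IZR k + p * IZR e)).
      assert (H3 := sech_le_1 (2 * p * IZR k + p * IZR e)). nra.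
    - eexists. apply is_sech_sum. lra. }
  assert (Hg := is_series_Z_opp _ _ (is_series_Z_shift _ _ (- e) Hf)).
  assert (H := is_series_Z_scal (sinh (p * IZR e)) _ _ (is_series_Z_plus _ _ _ _ Hf Hg)).
  assert (HT : sinh (p * IZR e) * (Series_Z f + Series_Z f) = 2 * IZR e).
  { apply (is_series_Z_uniq _ _ _ H).
    generalize (is_series_Z_tanh 0 (2 * p) e ltac:(lra)).
    apply is_series_Z_eq; [|reflexivity]. intros n. unfold f.
    rewrite plus_IZR, !opp_IZR.
    set (u := 2 * p * IZR n). set (w := p * IZR e).
    replace (2 * p * (- IZR n + - IZR e)) with (- (u + 2 * w)) by (unfold u, w; ring).
    replace (- (u + 2 * w) + w) with (- (u + w)) by ring.
    replace (0 + 2 * p * (IZR n + IZR e)) with (u + 2 * w) by (unfold u, w; ring).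
    rewrite Rplus_0_l, !sech_opp.
    (* Cutting the step at its midpoint gives sinh w times the term of [f] at n plus the reflected
       term of [f]. *)
    replace (tanh (u + 2 * w) - tanh u)
      with ((tanh (u + 2 * w) - tanh (u + w)) + (tanh (u + w) - tanh u)) by ring.
    rewrite !tanh_minus.
    replace (u + 2 * w - (u + w)) with w by ring. replace (u + w - u) with w by ring.
    ring. }
  revert Hf. apply is_series_Z_eq; [reflexivity|].
  apply (Rmult_eq_reg_l (2 * sinh (p * IZR e))); [|lra]. field_simplify; lra.
Qed.

(** * Lambert series *)

Lemma is_lim_seq_INR_exp (t : R) :
  0 < t -> is_lim_seq (fun n => INR n * exp (- (t * INR n))) 0.
Proof.
  intros Ht.
  assert (H : is_lim_seq (fun n => 2 / t * exp (- (t / 2 * INR n))) 0).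
  { apply ex_series_lim_0. eexists. apply is_series_Rscal, is_series_exp. lra. }
  apply (is_lim_seq_le_le (fun _ => 0) _ (fun n => 2 / t * exp (- (t / 2 * INR n))));
    [|apply is_lim_seq_const|exact H].
  intros n. assert (Hn := pos_INR n). set (w := t / 2 * INR n).
  replace (exp (- (t * INR n))) with (exp (- w) * exp (- w))
    by (rewrite <- exp_plus; f_equal; unfold w; field).
  assert (Hw := exp_pos (- w)). split.
  - apply Rmult_le_pos; nra.
  - rewrite <- Rmult_assoc. apply Rmult_le_compat_r; [lra|].
    replace (INR n) with (2 / t * w) by (unfold w; field; lra).
    assert (Hb : w * exp (- w) <= 1).
    { apply (Rmult_le_reg_r (exp w)); [apply exp_pos|].
      rewrite Rmult_assoc, <- exp_plus, Rplus_opp_l, exp_0.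
      generalize (exp_ineq1_le w). lra. }
    assert (0 < 2 / t) by (apply Rdiv_lt_0_compat; lra). nra.
Qed.

Lemma is_series_arith_geom (t : R) :
  0 < t ->
  is_series (fun n => (INR n + 1) * exp (- (t * INR n))) (/ (1 - exp (- t)) ^ 2).
Proof.
  intros Ht. set (z := exp (- t)).
  assert (Hz : 1 - z <> 0).
  { assert (z < 1); [|lra]. unfold z. rewrite <- exp_0. apply exp_increasing. lra. }
  (* This is the discrete primitive of (n + 1) z^n that vanishes at infinity. *)
  set (f := fun n => - / (1 - z) ^ 2 *
                     ((1 - z) * (INR n * exp (- (t * INR n))) + exp (- (t * INR n)))).
  assert (Hf : is_lim_seq f 0).
  { replace 0 with (- / (1 - z) ^ 2 * ((1 - z) * 0 + 0)) by ring.
    apply is_lim_seq_mult'; [apply is_lim_seq_const|]. apply is_lim_seq_plus'.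
    - apply is_lim_seq_mult'; [apply is_lim_seq_const|now apply is_lim_seq_INR_exp].
    - apply ex_series_lim_0. eexists. now apply is_series_exp. }
  generalize (is_series_telescope f 0 Hf). apply is_series_eq.
  - intros n. unfold f. rewrite S_INR.
    replace (exp (- (t * (INR n + 1)))) with (exp (- (t * INR n)) * z)
      by (unfold z; rewrite <- exp_plus; f_equal; ring).
    field. exact Hz.
  - unfold f. simpl. rewrite Rmult_0_r, Ropp_0, exp_0. field. exact Hz.
Qed.

Lemma sinh_exp (y : R) : sinh y = (1 - exp (- (2 * y))) / (2 * exp (- y)).
Proof.
  unfold sinh. replace (- (2 * y)) with (- y + - y) by ring.
  rewrite exp_plus, exp_Ropp. generalize (exp_pos y). intros. field. lra.
Qed.

Lemma is_series_csch_sqr (y : R) :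
  0 < y ->
  is_series (fun j => 4 * (INR j + 1) * exp (- (2 * y * (INR j + 1)))) ((/ sinh y) ^ 2).
Proof.
  intros Hy.
  generalize (is_series_Rscal (4 * exp (- (2 * y))) _ _ (is_series_arith_geom (2 * y) ltac:(lra))).
  apply is_series_eq.
  - intros j. replace (- (2 * y * (INR j + 1))) with (- (2 * y) + - (2 * y * INR j)) by ring.
    rewrite exp_plus. ring.
  - rewrite sinh_exp. replace (exp (- (2 * y))) with (exp (- y) * exp (- y)) at 1
      by (rewrite <- exp_plus; f_equal; ring).
    assert (exp (- (2 * y)) < 1) by (rewrite <- exp_0; apply exp_increasing; lra).
    generalize (exp_pos (- y)). intros. field. lra.
Qed.

Lemma is_series_inv_sinh (y : R) :
  0 < y -> is_series (fun n => exp (- (2 * y * (INR n + 1 / 2)))) (/ sinh y / 2).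
Proof.
  intros Hy.
  generalize (is_series_Rscal (exp (- y)) _ _ (is_series_exp (2 * y) ltac:(lra))).
  apply is_series_eq.
  - intros n. rewrite <- exp_plus. f_equal. field.
  - rewrite sinh_exp.
    assert (exp (- (2 * y)) < 1) by (rewrite <- exp_0; apply exp_increasing; lra).
    generalize (exp_pos (- y)). intros. field. lra.
Qed.

(* At k = 0 the value is 0, since 0 * / 0 = 0. *)
Definition lambert_term (x : R) (k : Z) : R := IZR k / sinh (x * IZR k).

Lemma lambert_term_0 (x : R) : lambert_term x 0 = 0.
Proof. unfold lambert_term, Rdiv. ring. Qed.

Lemma sinh_opp (y : R) : sinh (- y) = - sinh y.
Proof. unfold sinh. rewrite Ropp_involutive. field. Qed.

Lemma lambert_term_opp (x : R) (k : Z) : lambert_term x (- k) = lambert_term x k.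
Proof.
  unfold lambert_term. rewrite opp_IZR, Ropp_mult_distr_r_reverse, sinh_opp.
  unfold Rdiv. rewrite Rinv_opp. ring.
Qed.

Lemma is_series_Z_even_fun (a : Z -> R) (s : R) :
  (forall k, a (- k)%Z = a k) -> is_series_Z a s ->
  is_series (fun n => a (Z.of_nat (S n))) ((s - a 0%Z) / 2).
Proof.
  intros Ha (s1 & s2 & H1 & H2 & ->).
  assert (H3 : is_series (fun n => a (Z.of_nat (S n))) s2).
  { revert H2. apply is_series_eq; [|reflexivity]. intros n. apply Ha. }
  assert (H4 := is_series_tail _ _ H1).
  assert (E := is_series_uniq _ _ _ H3 H4). simpl in E.
  revert H3. apply is_series_eq; [reflexivity|]. lra.
Qed.

(** The array 4 (j + 1) exp (- 2 x (n + 1/2) (j + 1)) sums over j to the square of 1 / sinh (x (n +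
    1/2)), and over n to twice the Lambert term at j + 1. The indices n and - n - 1 give equal
    squares, hence the factor 2. *)
Lemma is_series_Z_csch_sqr (x V : R) :
  0 < x -> is_series_Z (lambert_term x) V ->
  is_series_Z (fun n => (/ sinh (x * (IZR n + 1 / 2))) ^ 2) (2 * V).
Proof.
  intros Hx HV.
  apply is_series_Z_even_fun in HV; [|apply lambert_term_opp].
  rewrite lambert_term_0, Rminus_0_r in HV.
  assert (H : is_series (fun n => (/ sinh (x * (INR n + 1 / 2))) ^ 2) V).
  { apply (is_series_tonelli
      (fun j n => 4 * (INR j + 1) * exp (- (2 * (x * (INR n + 1 / 2)) * (INR j + 1))))
      (fun j => 2 * lambert_term x (Z.of_nat (S j)))).
    - intros j n. generalize (pos_INR j) (exp_pos (- (2 * (x * (INR n + 1 / 2)) * (INR j + 1)))).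
      intros. apply Rmult_le_pos; lra.
    - intros j. assert (Hj := pos_INR j).
      generalize (is_series_Rscal (4 * (INR j + 1)) _ _
                    (is_series_inv_sinh (x * (INR j + 1)) ltac:(nra))).
      apply is_series_eq.
      + intros n. do 2 f_equal. ring.
      + unfold lambert_term. rewrite <- INR_IZR_INZ, S_INR. unfold Rdiv. field.
        apply sinh_neq_0. nra.
    - intros n. apply is_series_csch_sqr. generalize (pos_INR n). nra.
    - generalize (is_series_Rscal 2 _ _ HV). apply is_series_eq; [reflexivity|field]. }
  exists V, V. split; [|split; [|ring]].
  - revert H. apply is_series_eq; [|reflexivity]. intros n. now rewrite <- INR_IZR_INZ.
  - revert H. apply is_series_eq; [|reflexivity]. intros n.
    rewrite opp_IZR, <- INR_IZR_INZ, S_INR.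
    replace (x * (- (INR n + 1) + 1 / 2)) with (- (x * (INR n + 1 / 2))) by field.
    rewrite sinh_opp, Rinv_opp. ring.
Qed.

(** Since sinh (2 y) = 2 sinh y cosh y, the difference is (cosh^2 - 1) / (sinh^2 cosh^2) with cosh^2
    taken over the common denominator, that is 1 / cosh^2. It turns the diagonal terms into two
    Lambert series, at x and at 2x. *)
Lemma sech_sqr_csch (y : R) :
  y <> 0 -> sech y ^ 2 = (/ sinh y) ^ 2 - 4 * (/ sinh (2 * y)) ^ 2.
Proof.
  intros Hy. assert (Hs := sinh_neq_0 y Hy). assert (Hc := cosh_pos y).
  assert (E1 : sinh (2 * y) = 2 * sinh y * cosh y).
  { unfold sinh, cosh. replace (- (2 * y)) with (- y + - y) by ring.
    replace (2 * y) with (y + y) by ring. rewrite !exp_plus. field. }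
  assert (E2 : cosh y ^ 2 = 1 + sinh y ^ 2).
  { unfold sinh, cosh. rewrite exp_Ropp. generalize (exp_pos y). intros. field. lra. }
  unfold sech. rewrite E1. field_simplify_eq; [|split; lra]. rewrite E2. ring.
Qed.

(** The square of C(x) is arranged by the difference d of the two indices. For d nonzero the
    products telescope to 2 d / sinh (x d); the diagonal sum [Q] is added separately, which is
    consistent because [lambert_term x 0] is 0. *)
Lemma is_series_Z_sech_conv (x : R) :
  0 < x ->
  exists Q, is_series_Z (fun n => sech (x * (IZR n + 1 / 2)) ^ 2) Q /\
    is_series_Z (fun d => 2 * lambert_term x d + (if Z.eq_dec d 0 then Q else 0))
      (sech_sum x (1 / 2) ^ 2).
Proof.
  intros Hx. set (t := fun n => sech (x * (IZR n + 1 / 2))).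
  assert (Ht : is_series_Z t (sech_sum x (1 / 2))) by now apply is_sech_sum.
  assert (HQ : ex_series_Z (fun n => t n ^ 2)).
  { apply (ex_series_Z_le _ t); [|now exists (sech_sum x (1 / 2))].
    intros k. assert (H1 := sech_pos (x * (IZR k + 1 / 2))).
    assert (H2 := sech_le_1 (x * (IZR k + 1 / 2))). unfold t. nra. }
  destruct HQ as [Q HQ]. exists Q. split; [exact HQ|].
  apply (is_series_Z_tonelli (fun n d => t n * t (d + n)%Z) (fun n => t n * sech_sum x (1 / 2))).
  - intros n d. apply Rmult_le_pos; apply Rlt_le, sech_pos.
  - intros n. apply is_series_Z_scal. now apply is_series_Z_shift.
  - intros d. destruct (Z.eq_dec d 0) as [->|Hd].
    + rewrite lambert_term_0. revert HQ. apply is_series_Z_eq; [|ring].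
      intros n. rewrite Z.add_0_l. ring.
    + generalize (is_series_Z_sech_mul (x / 2) x d Hx Hd). unfold lambert_term.
      apply is_series_Z_eq; [|unfold Rdiv; ring]. intros n. unfold t. rewrite plus_IZR.
      f_equal; f_equal; field.
  - generalize (is_series_Z_scal (sech_sum x (1 / 2)) _ _ Ht).
    apply is_series_Z_eq; [|ring]. intros n. ring.
Qed.

(** Convergence is read off from the expansion of C(x)^2: remove the diagonal term and halve. *)
Lemma is_series_Z_lambert (x : R) :
  0 < x -> is_series_Z (lambert_term x) (Series_Z (lambert_term x)).
Proof.
  intros Hx. apply ex_series_Z_correct.
  destruct (is_series_Z_sech_conv x Hx) as (Q & _ & H).
  generalize (is_series_Z_plus _ _ _ _ H (is_series_Z_at_0 (- Q))). intros H'.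
  eexists. generalize (is_series_Z_scal (1 / 2) _ _ H').
  apply is_series_Z_eq; [|reflexivity]. intros k. destruct (Z.eq_dec k 0); field.
Qed.

Lemma sech_sum_half_sqr_lambert (x : R) :
  0 < x ->
  sech_sum x (1 / 2) ^ 2 = 4 * Series_Z (lambert_term x) - 8 * Series_Z (lambert_term (2 * x)).
Proof.
  intros Hx. destruct (is_series_Z_sech_conv x Hx) as (Q & HQ & H).
  assert (HV := is_series_Z_lambert x Hx).
  assert (HV2 := is_series_Z_lambert (2 * x) ltac:(lra)).
  rewrite (is_series_Z_uniq _ _ _ H
             (is_series_Z_plus _ _ _ _ (is_series_Z_scal 2 _ _ HV) (is_series_Z_at_0 Q))).
  assert (G1 := is_series_Z_csch_sqr x _ Hx HV).
  assert (G2 := is_series_Z_csch_sqr (2 * x) _ ltac:(lra) HV2).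
  assert (E : Q = 2 * Series_Z (lambert_term x) + - 4 * (2 * Series_Z (lambert_term (2 * x)))).
  { apply (is_series_Z_uniq _ _ _ HQ).
    generalize (is_series_Z_plus _ _ _ _ G1 (is_series_Z_scal (- 4) _ _ G2)).
    apply is_series_Z_eq; [|reflexivity]. intros n. rewrite sech_sqr_csch.
    - rewrite Rmult_assoc. ring.
    - apply Rmult_integral_contrapositive_currified; [lra|].
      intros Hn. assert (E : IZR (2 * n + 1) = IZR 0) by (rewrite plus_IZR, mult_IZR; lra).
      apply eq_IZR in E. lia. }
  rewrite E. ring.
Qed.

(** Splitting the Lambert series by parity, the even indices give 2 V(2x). An odd index 2 m + 1
    gives exactly the terms of A(2x) C(2x) whose indices differ by m + 1/2, by
    [is_series_Z_sech_mul_half]. *)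
Lemma sech_sum_mul_lambert (x : R) :
  0 < x ->
  Series_Z (lambert_term x) =
    2 * Series_Z (lambert_term (2 * x)) + sech_sum (2 * x) 0 * sech_sum (2 * x) (1 / 2).
Proof.
  intros Hx.
  assert (HV2 := is_series_Z_lambert (2 * x) ltac:(lra)).
  assert (H0 := is_sech_sum (2 * x) 0 ltac:(lra)).
  assert (H1 := is_sech_sum (2 * x) (1 / 2) ltac:(lra)).
  apply (is_series_Z_uniq _ _ _ (is_series_Z_lambert x Hx)).
  apply is_series_Z_even_odd.
  - generalize (is_series_Z_scal 2 _ _ HV2). apply is_series_Z_eq; [|reflexivity].
    intros k. unfold lambert_term. rewrite mult_IZR.
    replace (x * (2 * IZR k)) with (2 * x * IZR k) by ring. unfold Rdiv. ring.
  - apply (is_series_Z_tonelli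
      (fun n m => sech (2 * x * (IZR n + 0)) * sech (2 * x * (IZR (m + n) + 1 / 2)))
      (fun n => sech (2 * x * (IZR n + 0)) * sech_sum (2 * x) (1 / 2))).
    + intros n m. apply Rmult_le_pos; apply Rlt_le, sech_pos.
    + intros n. apply is_series_Z_scal. exact (is_series_Z_shift _ _ n H1).
    + intros m. generalize (is_series_Z_sech_mul_half x (2 * m + 1) Hx ltac:(lia)).
      apply is_series_Z_eq; [|reflexivity]. intros n. rewrite !plus_IZR, mult_IZR.
      f_equal; f_equal; field.
    + generalize (is_series_Z_scal (sech_sum (2 * x) (1 / 2)) _ _ H0).
      apply is_series_Z_eq; [|ring]. intros n. ring.
Qed.

Lemma sech_sum_half_sqr (x : R) :
  0 < x -> sech_sum x (1 / 2) ^ 2 = 4 * sech_sum (2 * x) 0 * sech_sum (2 * x) (1 / 2).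
Proof.
  intros Hx. rewrite sech_sum_half_sqr_lambert, (sech_sum_mul_lambert x Hx) by exact Hx. ring.
Qed.

(** * Gauss's integral for the arithmetic-geometric mean *)

Definition agm_form (a b t : R) : R := (a * cos t) ^ 2 + (b * sin t) ^ 2.

Definition agm_int (a b : R) : R := RInt (fun t => / sqrt (agm_form a b t)) 0 (PI / 2).

Lemma cos_sqr (t : R) : cos t ^ 2 = 1 - sin t ^ 2.
Proof. generalize (sin2_cos2 t). unfold Rsqr. lra. Qed.

Lemma agm_form_pos (a b t : R) : 0 < a -> 0 < b -> 0 < agm_form a b t.
Proof.
  intros Ha Hb. unfold agm_form. rewrite !Rpow_mult_distr, cos_sqr.
  generalize (SIN_bound t) (pow2_ge_0 (sin t)). intros.
  assert (sin t ^ 2 <= 1) by nra.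
  assert (0 < a ^ 2) by nra. assert (0 < b ^ 2) by nra.
  destruct (Rle_lt_dec (sin t ^ 2) (1 / 2)); nra.
Qed.

Lemma continuous_agm (a b t : R) :
  0 < a -> 0 < b -> continuous (fun t => / sqrt (agm_form a b t)) t.
Proof.
  intros Ha Hb. assert (H := agm_form_pos a b t Ha Hb).
  apply (ex_derive_continuous (V := R_NormedModule)). unfold agm_form in *. auto_derive.
  repeat split; trivial.
  apply Rgt_not_eq, sqrt_lt_R0, H.
Qed.

Lemma ex_RInt_agm (a b u v : R) :
  0 < a -> 0 < b -> ex_RInt (fun t => / sqrt (agm_form a b t)) u v.
Proof.
  intros Ha Hb. apply (ex_RInt_continuous (V := R_CompleteNormedModule)).
  intros t _. now apply continuous_agm.
Qed.

Lemma agm_int_bounds (a b m M : R) :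
  0 < m -> m <= a <= M -> m <= b <= M ->
  PI / 2 * / M <= agm_int a b <= PI / 2 * / m.
Proof.
  intros Hm Ha Hb. assert (HPI := PI_RGT_0).
  assert (Hconst : forall c, RInt (fun _ => c) 0 (PI / 2) = PI / 2 * c).
  { intros c. rewrite RInt_const. change scal with Rmult. simpl. now rewrite Rminus_0_r. }
  assert (Hf : forall t, m ^ 2 <= agm_form a b t <= M ^ 2).
  { intros t. unfold agm_form. rewrite !Rpow_mult_distr, cos_sqr.
    assert (m ^ 2 <= a ^ 2 <= M ^ 2) by (split; nra).
    assert (m ^ 2 <= b ^ 2 <= M ^ 2) by (split; nra).
    assert (0 <= sin t ^ 2 <= 1) by (generalize (SIN_bound t); split; nra).
    split; nra. }
  split; unfold agm_int; rewrite <- Hconst; apply RInt_le; try lra;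
    try apply ex_RInt_const; try (apply ex_RInt_agm; lra); intros t _.
  - apply Rinv_le_contravar; [apply sqrt_lt_R0; specialize (Hf t); nra|].
    rewrite <- (sqrt_pow2 M) by lra. apply sqrt_le_1_alt, Hf.
  - apply Rinv_le_contravar; [lra|].
    rewrite <- (sqrt_pow2 m) by lra. apply sqrt_le_1_alt, Hf.
Qed.

Lemma agm_int_scal (l a b : R) :
  0 < l -> 0 < a -> 0 < b -> agm_int (l * a) (l * b) = agm_int a b / l.
Proof.
  intros Hl Ha Hb. unfold agm_int.
  transitivity (RInt (fun t => scal (/ l) (/ sqrt (agm_form a b t))) 0 (PI / 2)).
  - apply RInt_ext. intros t _. change scal with Rmult. simpl.
    replace (agm_form (l * a) (l * b) t) with (l ^ 2 * agm_form a b t)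
      by (unfold agm_form; ring).
    rewrite sqrt_mult_alt by nra. rewrite sqrt_pow2 by lra. apply Rinv_mult.
  - rewrite (RInt_scal (V := R_CompleteNormedModule)) by now apply ex_RInt_agm.
    change scal with Rmult. simpl. unfold Rdiv. ring.
Qed.

(** By the symmetry t -> PI - t. The range doubles because Landen's angle sweeps [0, PI] while t
    sweeps [0, PI / 2]. *)
Lemma RInt_agm_0_PI (a b : R) :
  0 < a -> 0 < b -> RInt (fun t => / sqrt (agm_form a b t)) 0 PI = 2 * agm_int a b.
Proof.
  intros Ha Hb. unfold agm_int. set (f := fun t => / sqrt (agm_form a b t)).
  assert (HC : RInt f 0 (PI / 2) + RInt f (PI / 2) PI = RInt f 0 PI)
    by (apply (RInt_Chasles (V := R_CompleteNormedModule)); now apply ex_RInt_agm).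
  assert (HS : - RInt f PI (PI / 2) = RInt f (PI / 2) PI)
    by (apply (opp_RInt_swap (V := R_CompleteNormedModule)); now apply ex_RInt_agm).
  assert (H : RInt f PI (PI / 2) = - RInt f 0 (PI / 2)).
  { replace (RInt f PI (PI / 2)) with (RInt f (PI - 0) (PI - PI / 2)) by (f_equal; field).
    rewrite <- (RInt_comp f (fun t => PI - t) (fun _ => - 1)).
    - rewrite <- (RInt_opp (V := R_CompleteNormedModule)) by now apply ex_RInt_agm.
      apply RInt_ext. intros t _. change scal with Rmult. change opp with Ropp. simpl.
      unfold f, agm_form. rewrite sin_PI_x, (Rtrigo_facts.cos_pi_minus t).
      rewrite Ropp_mult_distr_r_reverse.
      replace ((- (a * cos t)) ^ 2) with ((a * cos t) ^ 2) by ring. ring.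
    - intros t _. now apply continuous_agm.
    - intros t _. split; [auto_derive; [trivial|ring]|apply continuous_const]. }
  change (RInt f 0 PI = 2 * RInt f 0 (PI / 2)). lra.
Qed.

(* Landen's substitution tan (phi - t) = (b / a) tan t, rewritten so as to
   stay smooth at t = PI / 2. *)
Definition landen (a b t : R) : R :=
  2 * t - atan ((a - b) * sin t * cos t / (a * cos t ^ 2 + b * sin t ^ 2)).

Lemma agm_int_landen (a b : R) :
  0 < a -> 0 < b -> agm_int ((a + b) / 2) (sqrt (a * b)) = agm_int a b.
Proof.
  intros Ha Hb. assert (Hab : 0 < sqrt (a * b)) by (apply sqrt_lt_R0; nra).
  assert (HP : forall t, 0 < a * cos t ^ 2 + b * sin t ^ 2).
  { intros t. rewrite cos_sqr.
    assert (0 <= sin t ^ 2 <= 1) by (generalize (SIN_bound t); split; nra).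
    destruct (Rle_lt_dec (sin t ^ 2) (1 / 2)); nra. }
  (* The denominator and numerator inside the arctangent are the legs of a right triangle with
     hypotenuse [sqrt (agm_form a b t)]; this makes the sine of the new angle explicit. *)
  assert (Hsq : forall t, (a * cos t ^ 2 + b * sin t ^ 2) ^ 2 +
                     ((a - b) * sin t * cos t) ^ 2 = agm_form a b t).
  { intros t. unfold agm_form. generalize (cos_sqr t). intros E.
    replace ((a * cos t) ^ 2 + (b * sin t) ^ 2)
      with (((a * cos t) ^ 2 + (b * sin t) ^ 2) * (sin t ^ 2 + cos t ^ 2))
      by (rewrite E; ring). ring. }
  assert (HD := fun t => agm_form_pos a b t Ha Hb).
  set (f := fun t => / sqrt (agm_form ((a + b) / 2) (sqrt (a * b)) t)).
  set (dg := fun t => (a + b) * (a * cos t ^ 2 + b * sin t ^ 2) / agm_form a b t).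
  (* The core of the substitution: the new integrand times the derivative of the angle is twice the
     old integrand, and the 2 matches the doubled range. *)
  assert (Hf : forall t, dg t * f (landen a b t) = 2 * / sqrt (agm_form a b t)).
  { intros t. unfold f.
    set (P := a * cos t ^ 2 + b * sin t ^ 2). set (N := (a - b) * sin t * cos t).
    assert (HPt : 0 < P) by apply HP. assert (HDt := HD t).
    assert (HPN : P ^ 2 + N ^ 2 = agm_form a b t) by apply Hsq.
    set (X := N / P).
    assert (HX : 1 + X² = agm_form a b t / P ^ 2)
      by (rewrite <- HPN; unfold X, Rsqr; field; lra).
    assert (Hsin : sin (landen a b t) ^ 2 =
                   ((a + b) * sin t * cos t) ^ 2 / agm_form a b t).
    { unfold landen. fold P N X. rewrite sin_minus, sin_atan, cos_atan, HX.
      rewrite sqrt_div_alt, sqrt_pow2 by nra. rewrite sin_2a, cos_2a.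
      assert (Hs : 0 < sqrt (agm_form a b t)) by now apply sqrt_lt_R0.
      replace (2 * sin t * cos t * (1 / (sqrt (agm_form a b t) / P)) -
               (cos t * cos t - sin t * sin t) * (X / (sqrt (agm_form a b t) / P)))
        with ((2 * sin t * cos t * P - (cos t * cos t - sin t * sin t) * N) /
              sqrt (agm_form a b t)) by (unfold X; field; lra).
      unfold Rdiv at 1. rewrite Rpow_mult_distr, pow_inv, pow2_sqrt by lra.
      unfold Rdiv. f_equal.
      replace (2 * sin t * cos t * P - (cos t * cos t - sin t * sin t) * N)
        with ((a + b) * sin t * cos t * (sin t ^ 2 + cos t ^ 2)) by (unfold P, N; ring).
      rewrite cos_sqr. f_equal. ring. }
    assert (E : agm_form ((a + b) / 2) (sqrt (a * b)) (landen a b t) =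
                ((a + b) / 2 * P) ^ 2 / agm_form a b t).
    { unfold agm_form at 1. rewrite !Rpow_mult_distr, pow2_sqrt, cos_sqr, Hsin by nra.
      field_simplify_eq; [|lra]. rewrite <- HPN. unfold P, N.
      replace (cos t ^ 2) with (1 - sin t ^ 2) by (symmetry; apply cos_sqr).
      generalize (cos_sqr t). intros Ec.
      ring_simplify. rewrite ?(Rmult_comm (cos t)).
      replace (cos t ^ 4) with ((cos t ^ 2) ^ 2) by ring. rewrite Ec. ring. }
    rewrite E, sqrt_div_alt by lra. rewrite sqrt_pow2 by nra.
    assert (Hs : 0 < sqrt (agm_form a b t)) by now apply sqrt_lt_R0.
    unfold dg. fold P. rewrite <- (sqrt_sqrt (agm_form a b t)) at 1 by lra.
    field. lra. }
  assert (Hdg : forall t, is_derive (landen a b) t (dg t)).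
  { intros t. unfold landen, dg. assert (HPt := HP t). assert (HDt := HD t).
    auto_derive; [lra|]. specialize (Hsq t).
    apply (Rmult_eq_reg_r (agm_form a b t)); [|lra].
    set (P := a * cos t ^ 2 + b * sin t ^ 2) in *. set (N := (a - b) * sin t * cos t) in *.
    replace ((a + b) * P / agm_form a b t * agm_form a b t) with ((a + b) * P) by (field; lra).
    transitivity (2 * agm_form a b t -
      ((a - b) * (cos t ^ 2 - sin t ^ 2) * P + 2 * (a - b) * (sin t * cos t) * N)).
    - replace (a * (cos t * (cos t * 1)) + b * (sin t * (sin t * 1))) with P
        by (unfold P; ring).
      rewrite <- Hsq. field. split; nra.
    - unfold agm_form, N, P.
      replace ((a - b) * (cos t ^ 2 - sin t ^ 2) * (a * cos t ^ 2 + b * sin t ^ 2) +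
               2 * (a - b) * (sin t * cos t) * ((a - b) * sin t * cos t))
        with ((a - b) * (a * cos t ^ 2 - b * sin t ^ 2) * (sin t ^ 2 + cos t ^ 2)) by ring.
      rewrite !Rpow_mult_distr, cos_sqr. ring. }
  assert (Hg0 : landen a b 0 = 0).
  { unfold landen. rewrite sin_0. unfold Rdiv. rewrite !Rmult_0_r, !Rmult_0_l, atan_0. ring. }
  assert (Hg1 : landen a b (PI / 2) = PI).
  { unfold landen. rewrite cos_PI2. unfold Rdiv. rewrite !Rmult_0_r, !Rmult_0_l, atan_0. field. }
  assert (H := RInt_comp f (landen a b) dg 0 (PI / 2)).
  rewrite Hg0, Hg1 in H. unfold f in H at 3. rewrite RInt_agm_0_PI in H by lra.
  apply (Rmult_eq_reg_l 2); [|lra]. rewrite <- H.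
  - transitivity (RInt (fun t => scal 2 (/ sqrt (agm_form a b t))) 0 (PI / 2)).
    + apply RInt_ext. intros t _. exact (Hf t).
    + now rewrite (RInt_scal (V := R_CompleteNormedModule)) by now apply ex_RInt_agm.
  - intros t _. apply continuous_agm; lra.
  - intros t _. split; [apply Hdg|].
    apply (ex_derive_continuous (V := R_NormedModule)). unfold dg, agm_form. auto_derive.
    apply Rgt_not_eq, HD.
Qed.

Lemma is_derive_arcsinh (u : R -> R) (du t : R) :
  is_derive u t du -> is_derive (fun t => arcsinh (u t)) t (du / sqrt (u t ^ 2 + 1)).
Proof.
  intros Hu. apply (is_derive_comp arcsinh u t (/ sqrt (u t ^ 2 + 1)) du); [|exact Hu].
  apply is_derive_Reals, derivable_pt_lim_arcsinh.
Qed.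

(** The factor sin t makes the integral elementary, with primitive - arcsinh ((b / c) cos t) / b. It
    is the comparison integral that carries the logarithmic growth as c tends to 0. *)
Lemma is_RInt_arcsinh_cos (b c : R) :
  0 < b -> 0 < c ->
  is_RInt (fun t => sin t / sqrt ((b * cos t) ^ 2 + c ^ 2)) 0 (PI / 2) (arcsinh (b / c) / b).
Proof.
  intros Hb Hc.
  assert (Hp : forall t, 0 < (b * cos t) ^ 2 + c ^ 2).
  { intros t. generalize (pow2_ge_0 (b * cos t)). nra. }
  replace (arcsinh (b / c) / b)
    with (- / b * arcsinh (b / c * cos (PI / 2)) - - / b * arcsinh (b / c * cos 0))
    by (rewrite cos_PI2, cos_0, Rmult_0_r, Rmult_1_r, arcsinh_0; field; lra).
  apply (is_RInt_derive (V := R_CompleteNormedModule) (fun t => - / b * arcsinh (b / c * cos t))).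
  - intros t _.
    assert (H : is_derive (fun t => b / c * cos t) t (- (b / c) * sin t))
      by (auto_derive; [trivial|ring]).
    assert (Hs : 0 < sqrt ((b * cos t) ^ 2 + c ^ 2)) by apply sqrt_lt_R0, Hp.
    replace (sin t / sqrt ((b * cos t) ^ 2 + c ^ 2))
      with (- / b * (- (b / c) * sin t / sqrt ((b / c * cos t) ^ 2 + 1))).
    + apply is_derive_scal. exact (is_derive_arcsinh _ _ _ H).
    + replace ((b / c * cos t) ^ 2 + 1) with (((b * cos t) ^ 2 + c ^ 2) / c ^ 2) by (field; lra).
      rewrite sqrt_div_alt, sqrt_pow2 by nra. field. lra.
  - intros t _. apply (ex_derive_continuous (V := R_NormedModule)). auto_derive.
    specialize (Hp t). repeat split; [lra|]. apply Rgt_not_eq, sqrt_lt_R0. lra.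
Qed.

(** Replacing c sin t by c enlarges the root, and a numerator sin t <= 1 lowers the integrand
    further to the elementary one. *)
Lemma agm_int_ge (a c : R) : 0 < a -> 0 < c -> arcsinh (a / c) / a <= agm_int a c.
Proof.
  intros Ha Hc. rewrite <- (is_RInt_unique _ _ _ _ (is_RInt_arcsinh_cos a c Ha Hc)).
  assert (HPI := PI_RGT_0). unfold agm_int. apply RInt_le; [lra| | |].
  - eexists. now apply is_RInt_arcsinh_cos.
  - now apply ex_RInt_agm.
  - intros t Ht. assert (0 < sin t) by (apply sin_gt_0; lra).
    assert (HD := agm_form_pos a c t Ha Hc). assert (H1 := SIN_bound t).
    assert (sqrt (agm_form a c t) <= sqrt ((a * cos t) ^ 2 + c ^ 2)).
    { apply sqrt_le_1_alt. unfold agm_form. rewrite (Rpow_mult_distr c).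
      assert (sin t ^ 2 <= 1) by nra. generalize (pow2_ge_0 c). nra. }
    assert (0 < sqrt (agm_form a c t)) by now apply sqrt_lt_R0.
    apply Rle_trans with (1 / sqrt ((a * cos t) ^ 2 + c ^ 2)).
    + apply Rmult_le_compat_r; [|lra]. apply Rlt_le, Rinv_0_lt_compat. lra.
    + unfold Rdiv. rewrite Rmult_1_l. now apply Rinv_le_contravar.
Qed.

(** Under a^2 = b^2 + c^2 the form equals (b cos t)^2 + c^2, so the elementary integrand falls short
    by (1 - sin t) / root. As the root is at least a cos t >= a (1 - sin t), the shortfall is at
    most 1 / a. *)
Lemma agm_int_le (a b c : R) :
  0 < a -> 0 < b -> 0 < c -> a ^ 2 = b ^ 2 + c ^ 2 ->
  agm_int a c <= arcsinh (b / c) / b + PI / 2 * / a.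
Proof.
  intros Ha Hb Hc E. assert (HPI := PI_RGT_0).
  assert (HI : is_RInt (fun t => sin t / sqrt ((b * cos t) ^ 2 + c ^ 2) + / a) 0 (PI / 2)
                 (arcsinh (b / c) / b + PI / 2 * / a)).
  { apply (is_RInt_plus (V := R_NormedModule)); [now apply is_RInt_arcsinh_cos|].
    replace (PI / 2) with (PI / 2 - 0) at 2 by ring.
    exact (is_RInt_const (V := R_NormedModule) 0 (PI / 2) (/ a)). }
  rewrite <- (is_RInt_unique _ _ _ _ HI). unfold agm_int. apply RInt_le; [lra| | |].
  - now apply ex_RInt_agm.
  - now eexists; apply HI.
  - intros t Ht. assert (0 < sin t) by (apply sin_gt_0; lra).
    assert (HD := agm_form_pos a c t Ha Hc). assert (H1 := SIN_bound t).
    assert (EF : agm_form a c t = (b * cos t) ^ 2 + c ^ 2).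
    { unfold agm_form. rewrite !Rpow_mult_distr, E, cos_sqr. ring. }
    rewrite <- EF. assert (Hs : 0 < sqrt (agm_form a c t)) by now apply sqrt_lt_R0.
    assert (Hle : (1 - sin t) * a <= sqrt (agm_form a c t)).
    { rewrite <- (sqrt_pow2 ((1 - sin t) * a)) by nra. apply sqrt_le_1_alt.
      unfold agm_form. rewrite !Rpow_mult_distr, cos_sqr.
      assert ((1 - sin t) ^ 2 <= 1 - sin t ^ 2) by nra.
      assert (0 <= c ^ 2 * sin t ^ 2) by nra. assert (0 < a ^ 2) by nra. nra. }
    apply (Rmult_le_reg_r (a * sqrt (agm_form a c t))); [nra|]. field_simplify; nra.
Qed.

(** * Evaluation of the integral at the secant sums *)

Lemma is_series_sech_nat (x : R) :
  0 < x -> is_series (fun n => sech (x * INR (S n))) ((sech_sum x 0 - 1) / 2).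
Proof.
  intros Hx. assert (H := is_series_Z_sech x Hx).
  apply is_series_Z_even_fun in H.
  - revert H. apply is_series_eq.
    + intros n. now rewrite <- INR_IZR_INZ.
    + rewrite Rmult_0_r. unfold sech. rewrite cosh_0. field.
  - intros k. rewrite opp_IZR, Ropp_mult_distr_r_reverse. apply sech_opp.
Qed.

Lemma is_series_sech_half (x : R) :
  0 < x -> is_series (fun n => sech (x * (INR n + 1 / 2))) (sech_sum x (1 / 2) / 2).
Proof.
  intros Hx. destruct (is_sech_sum x (1 / 2) Hx) as (s1 & s2 & H1 & H2 & ->).
  assert (H3 : is_series (fun n => sech (x * (INR n + 1 / 2))) s1).
  { revert H1. apply is_series_eq; [|reflexivity]. intros n. now rewrite <- INR_IZR_INZ. }
  assert (H4 : is_series (fun n => sech (x * (INR n + 1 / 2))) s2).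
  { revert H2. apply is_series_eq; [|reflexivity]. intros n.
    rewrite opp_IZR, <- INR_IZR_INZ, S_INR, <- sech_opp. f_equal. field. }
  rewrite (is_series_uniq _ _ _ H4 H3).
  revert H3. apply is_series_eq; [reflexivity|field].
Qed.

(** The first term bounds from below, a geometric series from above. The constant depends only on
    the threshold [x], hence is uniform along X = 2^n x. *)
Lemma series_sech_bounds (x X u s : R) :
  0 < x <= X -> 0 <= u -> is_series (fun n => sech (X * (INR n + u))) s ->
  exp (- (X * u)) <= s <= 2 * / (1 - exp (- x)) * exp (- (X * u)).
Proof.
  intros [Hx HX] Hu Hs. split.
  - apply Rle_trans with (sech (X * (0 + u))).
    + rewrite Rplus_0_l. apply sech_ge_exp. nra.
    + replace (sech (X * (0 + u))) with (sum_n (fun n => sech (X * (INR n + u))) 0)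
        by now rewrite sum_O.
      apply is_series_partial_le; [|exact Hs]. intros n. apply Rlt_le, sech_pos.
  - assert (Hg := is_series_Rscal (2 * exp (- (X * u))) _ _ (is_series_exp X ltac:(lra))).
    apply Rle_trans with (2 * exp (- (X * u)) * / (1 - exp (- X))).
    + rewrite <- (is_series_unique _ _ Hs), <- (is_series_unique _ _ Hg).
      apply Series_le; [|now eexists; apply Hg]. intros n.
      split; [apply Rlt_le, sech_pos|]. eapply Rle_trans; [apply sech_le_exp|].
      rewrite Rmult_assoc, <- exp_plus. apply Req_le. do 2 f_equal. ring.
    + assert (exp (- x) < 1) by (rewrite <- exp_0; apply exp_increasing; lra).
      assert (exp (- X) <= exp (- x)).
      { destruct (Req_dec x X) as [->|]; [lra|]. apply Rlt_le, exp_increasing. lra. }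
      assert (/ (1 - exp (- X)) <= / (1 - exp (- x))) by (apply Rinv_le_contravar; lra).
      generalize (exp_pos (- (X * u))). nra.
Qed.

Lemma sech_sum_0_bounds (x X : R) :
  0 < x <= X -> 1 <= sech_sum X 0 <= 1 + 4 * / (1 - exp (- x)) * exp (- X).
Proof.
  intros HX. assert (H := is_series_sech_nat X ltac:(lra)).
  assert (H' : is_series (fun n => sech (X * (INR n + 1))) ((sech_sum X 0 - 1) / 2)).
  { revert H. apply is_series_eq; [|reflexivity]. intros n. now rewrite S_INR. }
  generalize (series_sech_bounds x X 1 _ HX ltac:(lra) H') (exp_pos (- (X * 1))).
  rewrite Rmult_1_r. lra.
Qed.

Lemma sech_sum_half_bounds (x X : R) :
  0 < x <= X ->
  exp (- (X / 2)) <= sech_sum X (1 / 2) <= 4 * / (1 - exp (- x)) * exp (- (X / 2)).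
Proof.
  intros HX.
  generalize (series_sech_bounds x X (1 / 2) _ HX ltac:(lra) (is_series_sech_half X ltac:(lra)))
    (exp_pos (- (X / 2))).
  replace (X * (1 / 2)) with (X / 2) by field. lra.
Qed.

Lemma sech_sum_half_pos (x : R) : 0 < x -> 0 < sech_sum x (1 / 2).
Proof.
  intros Hx. generalize (sech_sum_half_bounds x x ltac:(lra)) (exp_pos (- (x / 2))). lra.
Qed.

(* The sum of (-1)^k sech (x k) over k. *)
Definition sech_alt (x : R) : R := sech_sum (2 * x) 0 - sech_sum (2 * x) (1 / 2).

(** A(x) and B(x) are the sum and the difference of A(2x) and C(2x), so A^2 - B^2 = 4 A(2x) C(2x),
    which is C(x)^2. *)
Lemma sech_pythagoras (x : R) :
  0 < x -> sech_sum x 0 ^ 2 = sech_alt x ^ 2 + sech_sum x (1 / 2) ^ 2.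
Proof.
  intros Hx. rewrite (sech_sum_half_sqr x Hx), (sech_sum_even_odd x Hx). unfold sech_alt. ring.
Qed.

Lemma sech_sum_double (x : R) :
  0 < x -> sech_sum (2 * x) 0 = (sech_sum x 0 + sech_alt x) / 2.
Proof. intros Hx. rewrite (sech_sum_even_odd x Hx). unfold sech_alt. field. Qed.

(** [sech_pythagoras] at 2x, with A(2x)^2 - C(2x)^2 factored. *)
Lemma sech_alt_double (x : R) :
  0 < x -> sech_alt (2 * x) ^ 2 = sech_sum x 0 * sech_alt x.
Proof.
  intros Hx. assert (H := sech_pythagoras (2 * x) ltac:(lra)).
  rewrite (sech_sum_even_odd x Hx). unfold sech_alt at 2. lra.
Qed.

Lemma le_pow2_mult (x : R) (n : nat) : 0 < x -> x <= 2 ^ n * x.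
Proof. intros Hx. generalize (pow_R1_Rle 2 n ltac:(lra)). nra. Qed.

Lemma is_lim_seq_pow2_exp (x : R) : 0 < x -> is_lim_seq (fun n => exp (- (2 ^ n * x))) 0.
Proof.
  intros Hx. apply (is_lim_seq_le_le (fun _ => 0) _ (fun n => exp (- (x * INR n)))).
  - intros n. split; [apply Rlt_le, exp_pos|].
    assert (H : INR n < 2 ^ n).
    { induction n as [|n IH]; [simpl; lra|]. rewrite S_INR. simpl.
      generalize (pow_R1_Rle 2 n ltac:(lra)). lra. }
    apply Rlt_le, exp_increasing. nra.
  - apply is_lim_seq_const.
  - apply ex_series_lim_0. eexists. now apply is_series_exp.
Qed.

Lemma is_lim_seq_sech_sum_0 (x : R) : 0 < x -> is_lim_seq (fun n => sech_sum (2 ^ n * x) 0) 1.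
Proof.
  intros Hx.
  apply (is_lim_seq_le_le (fun _ => 1) _
           (fun n => 1 + 4 * / (1 - exp (- x)) * exp (- (2 ^ n * x)))).
  - intros n. apply sech_sum_0_bounds. generalize (le_pow2_mult x n Hx). lra.
  - apply is_lim_seq_const.
  - replace 1 with (1 + 4 * / (1 - exp (- x)) * 0) at 1 by ring.
    apply is_lim_seq_plus'; [apply is_lim_seq_const|].
    apply is_lim_seq_mult'; [apply is_lim_seq_const|now apply is_lim_seq_pow2_exp].
Qed.

Lemma is_lim_seq_sech_sum_half (x : R) :
  0 < x -> is_lim_seq (fun n => sech_sum (2 ^ n * x) (1 / 2)) 0.
Proof.
  intros Hx.
  apply (is_lim_seq_le_le (fun _ => 0) _
           (fun n => 4 * / (1 - exp (- x)) * exp (- (2 ^ n * (x / 2))))).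
  - intros n. assert (HX := le_pow2_mult x n Hx).
    generalize (sech_sum_half_bounds x (2 ^ n * x) ltac:(lra))
      (sech_sum_half_pos (2 ^ n * x) ltac:(lra)).
    replace (2 ^ n * x / 2) with (2 ^ n * (x / 2)) by field. lra.
  - apply is_lim_seq_const.
  - replace 0 with (4 * / (1 - exp (- x)) * 0) at 1 by ring.
    apply is_lim_seq_mult'; [apply is_lim_seq_const|]. apply is_lim_seq_pow2_exp. lra.
Qed.

Lemma is_lim_seq_sech_alt (x : R) : 0 < x -> is_lim_seq (fun n => sech_alt (2 ^ n * x)) 1.
Proof.
  intros Hx. unfold sech_alt. replace 1 with (1 - 0) at 1 by ring.
  apply is_lim_seq_minus'.
  - generalize (is_lim_seq_sech_sum_0 (2 * x) ltac:(lra)). apply is_lim_seq_ext.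
    intros n. f_equal. ring.
  - generalize (is_lim_seq_sech_sum_half (2 * x) ltac:(lra)). apply is_lim_seq_ext.
    intros n. f_equal. ring.
Qed.

(** A difference of positive sums has no evident sign. But B(2y)^2 = A(y) B(y) carries positivity
    from 2y back to y, and B(2^n x) is near 1 for large n. *)
Lemma sech_alt_pos (x : R) : 0 < x -> 0 < sech_alt x.
Proof.
  intros Hx.
  assert (Hback : forall n y, 0 < y -> 0 < sech_alt (2 ^ n * y) -> 0 < sech_alt y).
  { induction n as [|n IH]; intros y Hy H.
    - simpl in H. now rewrite Rmult_1_l in H.
    - apply IH; [exact Hy|]. assert (Hn : 0 < 2 ^ n) by (apply pow_lt; lra).
      replace (2 ^ S n * y) with (2 * (2 ^ n * y)) in H by (simpl; ring).
      assert (E := sech_alt_double (2 ^ n * y) ltac:(nra)).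
      assert (HA := sech_sum_0_bounds (2 ^ n * y) (2 ^ n * y) ltac:(nra)).
      assert (0 < sech_alt (2 * (2 ^ n * y)) ^ 2) by nra. nra. }
  assert (Hlim := is_lim_seq_sech_alt x Hx).
  apply is_lim_seq_spec in Hlim. destruct (Hlim (mkposreal (1 / 2) ltac:(lra))) as [N HN].
  apply (Hback N x Hx). specialize (HN N (Nat.le_refl N)). simpl in HN.
  apply Rabs_def2 in HN. lra.
Qed.

Lemma sech_alt_lt (x : R) : 0 < x -> sech_alt x < sech_sum x 0.
Proof.
  intros Hx. rewrite (sech_sum_even_odd x Hx). unfold sech_alt.
  generalize (sech_sum_half_pos (2 * x) ltac:(lra)). lra.
Qed.

Lemma agm_int_sech_alt (x : R) : 0 < x -> agm_int (sech_sum x 0) (sech_alt x) = PI / 2.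
Proof.
  intros Hx.
  assert (Hstep : forall y, 0 < y ->
    agm_int (sech_sum (2 * y) 0) (sech_alt (2 * y)) = agm_int (sech_sum y 0) (sech_alt y)).
  { intros y Hy. assert (HA := sech_sum_0_bounds y y ltac:(lra)).
    rewrite <- (agm_int_landen (sech_sum y 0) (sech_alt y))
      by (generalize (sech_alt_pos y Hy); lra).
    rewrite sech_sum_double, <- sech_alt_double by exact Hy.
    rewrite sqrt_pow2; [reflexivity|]. apply Rlt_le, sech_alt_pos. lra. }
  assert (Hiter : forall n,
    agm_int (sech_sum (2 ^ n * x) 0) (sech_alt (2 ^ n * x)) = agm_int (sech_sum x 0) (sech_alt x)).
  { intros n. induction n as [|n IH]; [now rewrite pow_O, Rmult_1_l|].
    rewrite <- IH. rewrite <- (Hstep (2 ^ n * x)); [simpl; now rewrite Rmult_assoc|].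
    generalize (le_pow2_mult x n Hx). lra. }
  assert (Hb : forall n,
    PI / 2 * / sech_sum (2 ^ n * x) 0 <= agm_int (sech_sum x 0) (sech_alt x) <=
    PI / 2 * / sech_alt (2 ^ n * x)).
  { intros n. rewrite <- (Hiter n). assert (HX := le_pow2_mult x n Hx).
    assert (0 < 2 ^ n * x) by lra.
    assert (H1 := sech_alt_pos (2 ^ n * x) H). assert (H2 := sech_alt_lt (2 ^ n * x) H).
    apply agm_int_bounds; lra. }
  assert (Hlim : forall u : nat -> R, is_lim_seq u 1 ->
    is_lim_seq (fun n => PI / 2 * / u n) (PI / 2)).
  { intros u Hu.
    assert (H := is_lim_seq_mult' _ _ _ _ (is_lim_seq_const (PI / 2))
                   (is_lim_seq_div' _ _ 1 1 (is_lim_seq_const 1) Hu ltac:(lra))).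
    replace (PI / 2 * (1 / 1)) with (PI / 2) in H by field.
    revert H. apply is_lim_seq_ext. intros n. unfold Rdiv. ring. }
  apply Rle_antisym.
  - exact (is_lim_seq_le (fun _ => _) _ _ (PI / 2) (fun n => proj2 (Hb n)) (is_lim_seq_const _)
             (Hlim _ (is_lim_seq_sech_alt x Hx))).
  - exact (is_lim_seq_le _ (fun _ => _) (PI / 2) _ (fun n => proj1 (Hb n))
             (Hlim _ (is_lim_seq_sech_sum_0 x Hx)) (is_lim_seq_const _)).
Qed.

(** The arithmetic and geometric means of A(2x) and C(2x) are A(x) / 2 and C(x) / 2; homogeneity of
    degree -1 turns the halves into the factor 2. *)
Lemma agm_int_sech_half_double (x : R) :
  0 < x ->
  agm_int (sech_sum (2 * x) 0) (sech_sum (2 * x) (1 / 2)) =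
  2 * agm_int (sech_sum x 0) (sech_sum x (1 / 2)).
Proof.
  intros Hx. assert (HA := sech_sum_0_bounds x x ltac:(lra)).
  assert (HA2 := sech_sum_0_bounds (2 * x) (2 * x) ltac:(lra)).
  assert (HC := sech_sum_half_pos x Hx). assert (HC2 := sech_sum_half_pos (2 * x) ltac:(lra)).
  rewrite <- agm_int_landen, <- (sech_sum_even_odd x Hx) by lra.
  replace (sech_sum (2 * x) 0 * sech_sum (2 * x) (1 / 2)) with ((/ 2 * sech_sum x (1 / 2)) ^ 2)
    by (rewrite Rpow_mult_distr, sech_sum_half_sqr by exact Hx; field).
  rewrite sqrt_pow2 by lra. unfold Rdiv at 1. rewrite Rmult_comm, agm_int_scal by lra. field.
Qed.

Lemma arcsinh_bounds (y : R) : 0 < y -> ln y <= arcsinh y <= ln (2 * y + 1).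
Proof.
  intros Hy. unfold arcsinh. assert (H := sqrt_pos (y ^ 2 + 1)).
  assert (sqrt (y ^ 2 + 1) <= y + 1).
  { rewrite <- (sqrt_pow2 (y + 1)) by lra. apply sqrt_le_1_alt. nra. }
  split; apply ln_le; lra.
Qed.

(** C(X) lies between constant multiples of exp (- X / 2), so the logarithm in both comparison
    bounds is X / 2 up to constants depending on [x] only. *)
Lemma agm_int_sech_half_bounds (x X : R) :
  0 < x <= X ->
  (X / 2 - ln (4 * / (1 - exp (- x)))) / sech_sum X 0
  <= agm_int (sech_sum X 0) (sech_sum X (1 / 2)) <=
  (X / 2 + ln (2 * (1 + 4 * / (1 - exp (- x))) + 1)) / sech_alt X + PI / 2.
Proof.
  intros HX. assert (HPI := PI_RGT_0).
  assert (HA := sech_sum_0_bounds x X HX). assert (HC := sech_sum_half_bounds x X HX).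
  assert (HB := sech_alt_pos X ltac:(lra)). assert (HBA := sech_alt_lt X ltac:(lra)).
  assert (Hp := sech_sum_half_pos X ltac:(lra)).
  assert (Hc : 0 < / (1 - exp (- x))).
  { apply Rinv_0_lt_compat.
    assert (exp (- x) < 1) by (rewrite <- exp_0; apply exp_increasing; lra). lra. }
  set (c := / (1 - exp (- x))) in *.
  assert (He : exp (- X) < 1) by (rewrite <- exp_0; apply exp_increasing; lra).
  assert (He2 : exp (- (X / 2)) < 1) by (rewrite <- exp_0; apply exp_increasing; lra).
  assert (Hexp := exp_pos (- (X / 2))).
  assert (Hce : 0 < 4 * c * exp (- (X / 2))) by (apply Rmult_lt_0_compat; lra).
  split.
  - eapply Rle_trans; [|apply agm_int_ge; lra]. apply Rmult_le_compat_r.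
    { apply Rlt_le, Rinv_0_lt_compat. lra. }
    eapply Rle_trans; [|apply arcsinh_bounds, Rdiv_lt_0_compat; lra].
    replace (X / 2 - ln (4 * c)) with (ln (/ (4 * c * exp (- (X / 2)))))
      by (rewrite ln_Rinv, ln_mult, ln_exp by lra; lra).
    apply ln_le; [now apply Rinv_0_lt_compat|].
    rewrite <- (Rmult_1_l (/ _)). apply Rmult_le_compat; [lra| |lra|].
    + now apply Rlt_le, Rinv_0_lt_compat.
    + apply Rinv_le_contravar; lra.
  - eapply Rle_trans.
    { apply (agm_int_le _ (sech_alt X)); try lra. apply sech_pythagoras. lra. }
    apply Rplus_le_compat.
    + apply Rmult_le_compat_r; [apply Rlt_le, Rinv_0_lt_compat; lra|].
      eapply Rle_trans; [apply arcsinh_bounds, Rdiv_lt_0_compat; lra|].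
      rewrite <- (ln_exp (X / 2)) at 1. rewrite <- ln_mult; [|apply exp_pos|lra].
      apply ln_le; [generalize (Rdiv_lt_0_compat _ _ HB Hp); lra|].
      assert (H1 : sech_alt X / sech_sum X (1 / 2) <= (1 + 4 * c) * exp (X / 2)).
      { apply Rle_trans with ((1 + 4 * c) * / exp (- (X / 2))).
        - unfold Rdiv. apply Rmult_le_compat; [lra|apply Rlt_le, Rinv_0_lt_compat; lra|nra|].
          apply Rinv_le_contravar; lra.
        - rewrite <- exp_Ropp, Ropp_involutive. lra. }
      (* The summand 1 inside the logarithm is absorbed by exp (X / 2) >= 1, whence the constant 2
         (1 + 4 c) + 1. *)
      generalize (exp_ineq1_le (X / 2)). nra.
    + apply Rle_trans with (PI / 2 * 1); [|lra]. apply Rmult_le_compat_l; [lra|].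
      rewrite <- Rinv_1. apply Rinv_le_contravar; lra.
Qed.

Lemma agm_int_sech_half (x : R) :
  0 < x -> agm_int (sech_sum x 0) (sech_sum x (1 / 2)) = x / 2.
Proof.
  intros Hx. set (J := fun y => agm_int (sech_sum y 0) (sech_sum y (1 / 2))).
  change (J x = x / 2).
  assert (Hiter : forall n, J (2 ^ n * x) = 2 ^ n * J x).
  { intros n. induction n as [|n IH]; [now rewrite pow_O, !Rmult_1_l|].
    simpl. rewrite !Rmult_assoc, <- IH. apply (agm_int_sech_half_double (2 ^ n * x)).
    generalize (le_pow2_mult x n Hx). lra. }
  set (l1 := ln (4 * / (1 - exp (- x)))). set (l2 := ln (2 * (1 + 4 * / (1 - exp (- x))) + 1)).
  (* The bounds at 2^n x divided by 2^n: the constants [l1], [l2] and PI / 2 acquire a vanishing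
     factor, while A and B tend to 1, so both sides tend to x / 2. *)
  assert (Hb : forall n,
    (x / 2 - l1 * (/ 2) ^ n) / sech_sum (2 ^ n * x) 0 <= J x <=
    (x / 2 + l2 * (/ 2) ^ n) / sech_alt (2 ^ n * x) + PI / 2 * (/ 2) ^ n).
  { intros n. assert (HX := le_pow2_mult x n Hx). assert (H2n : 0 < 2 ^ n) by (apply pow_lt; lra).
    assert (HA := sech_sum_0_bounds x (2 ^ n * x) ltac:(lra)).
    assert (HB := sech_alt_pos (2 ^ n * x) ltac:(lra)).
    assert (H := agm_int_sech_half_bounds x (2 ^ n * x) ltac:(lra)).
    fold (J (2 ^ n * x)) in H. rewrite Hiter in H. fold l1 l2 in H.
    rewrite pow_inv. split; apply (Rmult_le_reg_l (2 ^ n)); trivial.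
    - eapply Rle_trans; [|apply H]. apply Req_le. field. lra.
    - eapply Rle_trans; [apply H|]. apply Req_le. field. lra. }
  assert (Hgeom : is_lim_seq (fun n => (/ 2) ^ n) 0)
    by (apply is_lim_seq_geom; rewrite Rabs_pos_eq; lra).
  assert (Hsc : forall v, is_lim_seq (fun n => v * (/ 2) ^ n) 0).
  { intros v. replace 0 with (v * 0) by ring.
    apply is_lim_seq_mult'; [apply is_lim_seq_const|exact Hgeom]. }
  apply Rle_antisym.
  - apply (is_lim_seq_le (fun _ => J x)
      (fun n => (x / 2 + l2 * (/ 2) ^ n) / sech_alt (2 ^ n * x) + PI / 2 * (/ 2) ^ n)
      (J x) (x / 2)); [intros n; apply Hb|apply is_lim_seq_const|].
    replace (x / 2) with ((x / 2 + 0) / 1 + 0) at 1 by field.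
    apply is_lim_seq_plus'; [|apply Hsc]. apply is_lim_seq_div'; [|now apply is_lim_seq_sech_alt|lra].
    apply is_lim_seq_plus'; [apply is_lim_seq_const|apply Hsc].
  - apply (is_lim_seq_le (fun n => (x / 2 - l1 * (/ 2) ^ n) / sech_sum (2 ^ n * x) 0)
      (fun _ => J x) (x / 2) (J x)); [intros n; apply Hb| |apply is_lim_seq_const].
    replace (x / 2) with ((x / 2 - 0) / 1) at 1 by field.
    apply is_lim_seq_div'; [|now apply is_lim_seq_sech_sum_0|lra].
    apply is_lim_seq_minus'; [apply is_lim_seq_const|apply Hsc].
Qed.

(** * The elliptic modulus and the functional equation *)

Lemma ellipticK_agm (k : R) : 0 <= 1 - k ^ 2 -> ellipticK k = agm_int 1 (sqrt (1 - k ^ 2)).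
Proof.
  intros Hk. apply RInt_ext. intros t _. unfold Rdiv. rewrite Rmult_1_l. do 2 f_equal.
  unfold agm_form. rewrite !Rpow_mult_distr, pow2_sqrt, cos_sqr by exact Hk. ring.
Qed.

Lemma agm_int_lt (a b1 b2 : R) : 0 < a -> 0 < b1 < b2 -> agm_int a b2 < agm_int a b1.
Proof.
  intros Ha Hb. assert (HPI := PI_RGT_0). unfold agm_int. apply RInt_lt; [lra| | |].
  - intros t _. apply continuous_agm; lra.
  - intros t _. apply continuous_agm; lra.
  - intros t Ht. assert (Hs : 0 < sin t) by (apply sin_gt_0; lra).
    assert (H1 := agm_form_pos a b1 t Ha ltac:(lra)).
    assert (H2 : agm_form a b1 t < agm_form a b2 t).
    { unfold agm_form. rewrite !(Rpow_mult_distr _ (sin t)).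
      assert (0 < sin t ^ 2) by nra. assert (b1 ^ 2 < b2 ^ 2) by nra. nra. }
    apply Rinv_lt_contravar; [|apply sqrt_lt_1_alt; lra].
    apply Rmult_lt_0_compat; apply sqrt_lt_R0; lra.
Qed.

Lemma ellipticK_lt (k1 k2 : R) : 0 < k1 < k2 -> k2 < 1 -> ellipticK k1 < ellipticK k2.
Proof.
  intros H1 H2. rewrite !ellipticK_agm by nra. apply agm_int_lt; [lra|].
  split; [apply sqrt_lt_R0|apply sqrt_lt_1_alt]; nra.
Qed.

Lemma ellipticK_pos (k : R) : 0 < k < 1 -> 0 < ellipticK k.
Proof.
  intros Hk. assert (HPI := PI_RGT_0). rewrite ellipticK_agm by nra.
  assert (0 < sqrt (1 - k ^ 2)) by (apply sqrt_lt_R0; nra).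
  assert (sqrt (1 - k ^ 2) <= 1) by (rewrite <- sqrt_1 at 2; apply sqrt_le_1_alt; nra).
  generalize (agm_int_bounds 1 (sqrt (1 - k ^ 2)) (sqrt (1 - k ^ 2)) 1). rewrite Rinv_1. lra.
Qed.

Lemma comodulus_bounds (k : R) : 0 < k < 1 -> 0 < sqrt (1 - k ^ 2) < 1.
Proof.
  intros Hk. split; [apply sqrt_lt_R0; nra|].
  rewrite <- sqrt_1 at 2. apply sqrt_lt_1_alt. nra.
Qed.

(** K increases with the modulus, and the comodulus decreases, so numerator and denominator both
    push the ratio down. *)
Lemma elliptic_ratio_lt (k1 k2 : R) :
  0 < k1 < k2 -> k2 < 1 -> ellipticK' k2 / ellipticK k2 < ellipticK' k1 / ellipticK k1.
Proof.
  intros H1 H2. unfold ellipticK'.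
  assert (E1 := ellipticK_lt k1 k2 H1 H2).
  assert (P1 := ellipticK_pos k1 ltac:(lra)).
  assert (C1 := comodulus_bounds k1 ltac:(lra)). assert (C2 := comodulus_bounds k2 ltac:(lra)).
  assert (P2 := ellipticK_pos _ C2).
  assert (E2 : ellipticK (sqrt (1 - k2 ^ 2)) < ellipticK (sqrt (1 - k1 ^ 2))).
  { apply ellipticK_lt; [|lra]. split; [lra|]. apply sqrt_lt_1_alt. nra. }
  unfold Rdiv. apply Rmult_gt_0_lt_compat; try lra.
  - apply Rinv_0_lt_compat. lra.
  - apply Rinv_lt_contravar; nra.
Qed.

Lemma is_elliptic_modulus_uniq (r k1 k2 : R) :
  is_elliptic_modulus r k1 -> is_elliptic_modulus r k2 -> k1 = k2.
Proof.
  intros [H1 E1] [H2 E2]. destruct (Rtotal_order k1 k2) as [H|[H|H]]; [|exact H|].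
  - generalize (elliptic_ratio_lt k1 k2 ltac:(lra) ltac:(lra)). lra.
  - generalize (elliptic_ratio_lt k2 k1 ltac:(lra) ltac:(lra)). lra.
Qed.

(** The elliptic modulus with nome exp (- x), classically theta_2^2 / theta_3^2. *)
Definition sech_modulus (x : R) : R := sech_sum x (1 / 2) / sech_sum x 0.

Lemma sech_modulus_bounds (x : R) : 0 < x -> 0 < sech_modulus x < 1.
Proof.
  intros Hx. assert (HA := sech_sum_0_bounds x x ltac:(lra)). assert (HC := sech_sum_half_pos x Hx).
  assert (HB := sech_alt_pos x Hx). assert (E := sech_pythagoras x Hx). unfold sech_modulus.
  split; [apply Rdiv_lt_0_compat; lra|].
  apply (Rmult_lt_reg_r (sech_sum x 0)); [lra|].
  unfold Rdiv. rewrite Rmult_assoc, Rinv_l by lra. nra.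
Qed.

Lemma sech_comodulus (x : R) :
  0 < x -> sqrt (1 - sech_modulus x ^ 2) = sech_alt x / sech_sum x 0.
Proof.
  intros Hx. assert (HA := sech_sum_0_bounds x x ltac:(lra)). assert (HB := sech_alt_pos x Hx).
  replace (1 - sech_modulus x ^ 2) with ((sech_alt x / sech_sum x 0) ^ 2).
  - apply sqrt_pow2, Rlt_le, Rdiv_lt_0_compat; lra.
  - unfold sech_modulus. field_simplify_eq; [|lra]. rewrite (sech_pythagoras x Hx). ring.
Qed.

Lemma agm_int_div (a b : R) : 0 < a -> 0 < b -> agm_int 1 (b / a) = a * agm_int a b.
Proof.
  intros Ha Hb. assert (Hba : 0 < b / a) by now apply Rdiv_lt_0_compat.
  replace (agm_int a b) with (agm_int (a * 1) (a * (b / a))) by (f_equal; field; lra).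
  rewrite agm_int_scal by lra. field. lra.
Qed.

Lemma ellipticK_sech_modulus (x : R) :
  0 < x -> ellipticK (sech_modulus x) = sech_sum x 0 * (PI / 2).
Proof.
  intros Hx. assert (HA := sech_sum_0_bounds x x ltac:(lra)). assert (HB := sech_alt_pos x Hx).
  assert (Hk := sech_modulus_bounds x Hx).
  rewrite ellipticK_agm, sech_comodulus, agm_int_div, agm_int_sech_alt; nra.
Qed.

Lemma ellipticK'_sech_modulus (x : R) :
  0 < x -> ellipticK' (sech_modulus x) = sech_sum x 0 * (x / 2).
Proof.
  intros Hx. assert (HA := sech_sum_0_bounds x x ltac:(lra)). assert (HC := sech_sum_half_pos x Hx).
  assert (Hk := sech_modulus_bounds x Hx). unfold ellipticK'.
  assert (E : 1 - sqrt (1 - sech_modulus x ^ 2) ^ 2 = sech_modulus x ^ 2)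
    by (rewrite pow2_sqrt; nra).
  rewrite ellipticK_agm, E, sqrt_pow2 by nra. unfold sech_modulus.
  rewrite agm_int_div, agm_int_sech_half; lra.
Qed.

(** This supplies existence of the modulus for [lambda_star], by an explicit witness; uniqueness is
    the monotonicity of the ratio. *)
Lemma is_elliptic_modulus_sech (x r : R) :
  0 < x -> sqrt r = x / PI -> is_elliptic_modulus r (sech_modulus x).
Proof.
  intros Hx Hr. assert (HPI := PI_RGT_0). assert (HA := sech_sum_0_bounds x x ltac:(lra)).
  split; [now apply sech_modulus_bounds|].
  rewrite ellipticK_sech_modulus, ellipticK'_sech_modulus, Hr by exact Hx. field. lra.
Qed.

Lemma sech_sum_0_dual (x : R) :
  0 < x -> sech_sum x 0 = PI / x * sech_sum (PI ^ 2 / x) 0.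
Proof.
  intros Hx. assert (HPI := PI_RGT_0). set (y := PI ^ 2 / x).
  assert (Hy : 0 < y) by (unfold y; apply Rdiv_lt_0_compat; nra).
  assert (HA := sech_sum_0_bounds x x ltac:(lra)).
  assert (Hpx : 0 < PI / x) by (now apply Rdiv_lt_0_compat).
  assert (Hk := sech_modulus_bounds x Hx). set (k' := sqrt (1 - sech_modulus x ^ 2)).
  assert (Ek : sqrt (1 - k' ^ 2) = sech_modulus x).
  { unfold k'. rewrite pow2_sqrt by nra.
    replace (1 - (1 - sech_modulus x ^ 2)) with (sech_modulus x ^ 2) by ring.
    apply sqrt_pow2. lra. }
  assert (EK := ellipticK'_sech_modulus x Hx). unfold ellipticK' in EK. fold k' in EK.
  (* Passing to the comodulus inverts the ratio x / PI, and y / PI = PI / x; both moduli thus belong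
     to r = (PI / x)^2. *)
  assert (E : sech_modulus y = k').
  { apply (is_elliptic_modulus_uniq ((PI / x) ^ 2)).
    - apply is_elliptic_modulus_sech; [exact Hy|]. rewrite sqrt_pow2 by lra.
      unfold y. field. lra.
    - split; [now apply comodulus_bounds|]. unfold ellipticK'.
      rewrite Ek, EK, ellipticK_sech_modulus, sqrt_pow2 by lra. field. lra. }
  (* K(k') is evaluated twice: as A(y) PI / 2 and, being K' of the modulus at x, as A(x) x / 2. *)
  assert (H := ellipticK_sech_modulus y Hy). rewrite E, EK in H.
  apply (Rmult_eq_reg_r (x / 2)); [|lra]. rewrite H. field. lra.
Qed.

Lemma lambda_star_sech_modulus (x r : R) :
  0 < x -> sqrt r = x / PI -> lambda_star r = sech_modulus x.
Proof.
  intros Hx Hr. assert (H := is_elliptic_modulus_sech x r Hx Hr).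
  apply (is_elliptic_modulus_uniq r); [|exact H].
  apply (iota_correct (is_elliptic_modulus r)).
  exists (sech_modulus x). split; [exact H|]. intros k Hk.
  exact (is_elliptic_modulus_uniq r _ _ H Hk).
Qed.

Lemma F_term_sech (x : R) (n : nat) : F_term x n = 1 / 2 * sech (x * INR n).
Proof.
  unfold F_term, sech, cosh.
  replace (- (2 * INR n * x)) with (- (x * INR n) + - (x * INR n)) by ring.
  replace (INR n * x) with (x * INR n) by ring.
  rewrite exp_plus, exp_Ropp. generalize (exp_pos (x * INR n)). intros. field.
  split; nra.
Qed.

(** The 1 is the term sech 0; one factor 1/2 comes from evenness, the other from [F_term_sech]. *)
Lemma is_series_F (x : R) :
  0 < x -> is_series (fun n => F_term x (S n)) ((sech_sum x 0 - 1) / 4).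
Proof.
  intros Hx. generalize (is_series_Rscal (1 / 2) _ _ (is_series_sech_nat x Hx)).
  apply is_series_eq; [|field]. intros n. now rewrite F_term_sech.
Qed.

Theorem theorem2p3 :
  (forall x : R, 0 < x ->
     ex_series_Z (fun k : Z => sech (x * IZR k)) /\
     ex_series (fun n : nat => F_term x (S n)) /\
     Series_Z (fun k : Z => sech (x * IZR k)) =
       PI / x * Series_Z (fun k : Z => sech (PI ^ 2 / x * IZR k)) /\
     (Series_Z (fun k : Z => sech (x * IZR k)) =
        PI / x * Series_Z (fun k : Z => sech (PI ^ 2 / x * IZR k)) <->
      F x = PI / (4 * x) - 1 / 4 + PI / x * F (PI ^ 2 / x))) /\
  (forall r : nat, (1 <= r)%nat -> is_pmf_Z (q r)).
Proof.
  assert (HPI := PI_RGT_0). split.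
  - intros x Hx.
    assert (Hy : 0 < PI ^ 2 / x) by (apply Rdiv_lt_0_compat; nra).
    assert (EF : forall z, 0 < z -> F z = (sech_sum z 0 - 1) / 4)
      by (intros z Hz; now apply is_series_unique, is_series_F).
    rewrite (is_series_Z_unique _ _ (is_series_Z_sech x Hx)),
      (is_series_Z_unique _ _ (is_series_Z_sech _ Hy)), !EF by assumption.
    split; [|split; [|split]].
    + eexists. now apply is_series_Z_sech.
    + eexists. now apply is_series_F.
    + now apply sech_sum_0_dual.
    (* After F = (A - 1) / 4 the two equations differ only by an affine change, so each implies the
       other by linear arithmetic. *)
    + replace (PI / (4 * x)) with (PI / x / 4) by (field; lra). lra.
  - intros r Hr.
    assert (Hs : 0 < sqrt (INR r)) by (apply sqrt_lt_R0, lt_0_INR; lia).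
    (* Chosen so that x / PI = sqrt r, the ratio defining k_r, while PI^2 / x = PI / sqrt r is the
       argument in [q]. *)
    set (x := PI * sqrt (INR r)). assert (Hx : 0 < x) by (unfold x; nra).
    assert (Hl : lambda_star (INR r) = sech_modulus x)
      by (apply lambda_star_sech_modulus; [exact Hx|unfold x; field; lra]).
    assert (HA := sech_sum_0_bounds x x ltac:(lra)).
    assert (HK : ellipticK (lambda_star (INR r)) = sech_sum x 0 * (PI / 2))
      by (rewrite Hl; now apply ellipticK_sech_modulus).
    assert (Hy : 0 < PI / sqrt (INR r)) by now apply Rdiv_lt_0_compat.
    split.
    + intros k. unfold q. rewrite HK. apply Rmult_le_pos; [|apply Rlt_le, sech_pos].
      apply Rlt_le, Rdiv_lt_0_compat; [lra|]. apply Rmult_lt_0_compat; nra.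
    + unfold q. rewrite HK.
      generalize (is_series_Z_scal (PI / (sqrt (INR r) * (2 * (sech_sum x 0 * (PI / 2))))) _ _
                    (is_series_Z_sech _ Hy)).
      apply is_series_Z_eq; [reflexivity|].
      (* Duality gives A(PI / sqrt r) = sqrt r A(x), and 2 K(k_r) = PI A(x), so the total mass is
         1. *)
      assert (E := sech_sum_0_dual x Hx).
      replace (PI ^ 2 / x) with (PI / sqrt (INR r)) in E by (unfold x; field; lra).
      replace (PI / x) with (/ sqrt (INR r)) in E by (unfold x; field; lra).
      assert (0 < sech_sum (PI / sqrt (INR r)) 0)
        by (generalize (sech_sum_0_bounds _ (PI / sqrt (INR r)) (conj Hy (Rle_refl _))); lra).
      rewrite E. field. lra.
Qed.
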